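(* Consider the random profile matching problem RPMP-$k$ (defined in the context) with $n$ men, $n$ women and $k=k(n)\ge 1$, where $d$ is an arbitrary metric on $Q_k$. Fix $\epsilon>0$. Then, with high probability (i.e., with probability tending to $1$ as $n\to\infty$): (i) if $k<(1-\epsilon)\log n$, the fraction of participants with multiple stable partners tends to zero as $n\to\infty$ (tie-breaking lists being used to form the preference lists); and (ii) if $k=\lfloor\log n\rfloor$, there are $O(n)$ participants with multiple stable partners and there are exponentially many (in $n$) stable matchings.
   Context: RPMP-$k$: there is a set $\mathcal{M}$ of $n$ men and a set $\mathcal{W}$ of $n$ women. Each participant $x$ has a profile $\mathbf{a}(x)\in Q_k=\{0,1\}^k$; the profiles of all participants are independent and uniformly distributed on $Q_k$. Let $d$ be a metric on $Q_k$ and write $d(x,y)=d(\mathbf{a}(x),\mathbf{a}(y))$. Each participant $x$ has a tie-breaking list $T_x$, a uniformly random ordering of the members of the opposite sex, all tie-breaking lists being independent of each other and of the profiles. The strict preference list of $x$ ranks the opposite sex in increasing order of $d(x,\cdot)$, breaking ties by $T_x$. A matching pairs men and women (each person matched to at most one partner); a pair $(m,w)$ not matched together blocks it if each prefers the other to his/her assigned partner; a matching is stable if no blocking pair exists. $y$ is a stable partner of $x$ if $x$ and $y$ are matched in some stable matching. Here $\log$ denotes the base-$2$ logarithm. *)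

(* Defs.v *)
From HB Require Import structures.
From mathcomp Require Import all_boot all_order all_algebra all_fingroup.
From mathcomp Require Import all_classical all_reals.
From mathcomp Require Import topology normedtype sequences exp.
Set Implicit Arguments. Unset Strict Implicit. Unset Printing Implicit Defensive.
Import Order.TTheory GRing.Theory Num.Theory.
Local Open Scope ring_scope.

Definition profile (k : nat) := {ffun 'I_k -> bool}.

Definition is_metric (R : realType) (k : nat) (d : profile k -> profile k -> R) : Prop :=
  [/\ (forall x y, 0 <= d x y),
      (forall x y, d x y = 0 <-> x = y),
      (forall x y, d x y = d y x) &
      (forall x y z, d x z <= d x y + d y z)].

(* A random instance (sample point): men's profiles, women's profiles,
   men's tie-breaking lists, women's tie-breaking lists.  Men and women are
   both indexed by 'I_n.  A tie-breaking list of x is a permutation s of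
   the opposite sex, the rank (position) of y in the list being s y. *)
Definition outcome (n k : nat) : finType :=
  ({ffun 'I_n -> profile k} * {ffun 'I_n -> profile k}
   * {ffun 'I_n -> {perm 'I_n}} * {ffun 'I_n -> {perm 'I_n}})%type.

(* A (partial) matching: M m = Some w means man m is matched to woman w. *)
Definition matching_fun (n : nat) := {ffun 'I_n -> option 'I_n}.

Section Model.
Variables (R : realType) (n k : nat) (d : profile k -> profile k -> R)
  (o : outcome n k).

Definition prof_man (m : 'I_n) : profile k := o.1.1.1 m.
Definition prof_woman (w : 'I_n) : profile k := o.1.1.2 w.
Definition tb_man (m : 'I_n) : {perm 'I_n} := o.1.2 m.
Definition tb_woman (w : 'I_n) : {perm 'I_n} := o.2 w.

Definition man_prefers (m w1 w2 : 'I_n) : bool :=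
  let d1 := d (prof_man m) (prof_woman w1) in
  let d2 := d (prof_man m) (prof_woman w2) in
  (d1 < d2) || ((d1 == d2) && (tb_man m w1 < tb_man m w2)%N).

Definition woman_prefers (w m1 m2 : 'I_n) : bool :=
  let d1 := d (prof_woman w) (prof_man m1) in
  let d2 := d (prof_woman w) (prof_man m2) in
  (d1 < d2) || ((d1 == d2) && (tb_woman w m1 < tb_woman w m2)%N).

Definition is_matching (M : matching_fun n) : bool :=
  [forall m1, forall m2, (M m1 != None) ==> (M m1 == M m2) ==> (m1 == m2)].

Definition man_improves (M : matching_fun n) (m w : 'I_n) : bool :=
  if M m is Some w' then man_prefers m w w' else true.

(* w prefers m to her assigned partner (being unmatched is worst) *)
Definition woman_improves (M : matching_fun n) (m w : 'I_n) : bool :=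
  [forall m', (M m' == Some w) ==> woman_prefers w m m'].

Definition blocking (M : matching_fun n) (m w : 'I_n) : bool :=
  [&& M m != Some w, man_improves M m w & woman_improves M m w].

Definition stable (M : matching_fun n) : bool :=
  is_matching M && [forall m, forall w, ~~ blocking M m w].

Definition n_stable_partners_man (m : 'I_n) : nat :=
  #|[set w : 'I_n | [exists M : matching_fun n, stable M && (M m == Some w)]]|.
Definition n_stable_partners_woman (w : 'I_n) : nat :=
  #|[set m : 'I_n | [exists M : matching_fun n, stable M && (M m == Some w)]]|.

Definition n_multi : nat :=
  #|[set m : 'I_n | (1 < n_stable_partners_man m)%N]|
  + #|[set w : 'I_n | (1 < n_stable_partners_woman w)%N]|.

Definition n_stable_matchings : nat := #|[set M : matching_fun n | stable M]|.

End Model.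

(* probability of an event under the uniform (product) distribution on
   instances: profiles i.i.d. uniform on Q_k, tie-breaking lists i.i.d.
   uniform permutations, all independent *)
Definition prob (R : realType) (n k : nat) (E : pred (outcome n k)) : R :=
  #|[set o | E o]|%:R / #|{: outcome n k}|%:R.

Definition log2 (R : realType) (x : R) : R := ln x / ln 2.

(* Main.v *)
Require Import Defs.
From HB Require Import structures.
From mathcomp Require Import all_boot all_order all_algebra all_fingroup.
From mathcomp Require Import all_classical all_reals.
From mathcomp Require Import topology normedtype sequences exp.
From mathcomp Require Import ring lra zify.
Set Implicit Arguments. Unset Strict Implicit. Unset Printing Implicit Defensive.
Import Order.TTheory GRing.Theory Num.Theory numFieldNormedType.Exports.

(* Call "class" the set of people with a given profile.  Since distance 0 is
   preferred to everything else, a stable matching restricts to a stable matching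
   of every class, with respect to the tie-breaking lists; the short side of a
   class is entirely matched inside it.

   (i) Let the two sides of a class differ by D in size.  Only D people of the
   class are matched outside of it.  If a long-side member w has a
   stable partner m in the class besides the one given by short-side-proposing
   deferred acceptance, then m still reaches w in deferred acceptance when w
   refuses everybody else.  Exchanging w with any of the D unmatched long-side
   members in the list of m gives D new families of lists, and (lists, unmatched
   member) can be recovered from the result, so w has several partners with
   probability at most 1/D.  For the profiles, D has
   mean square at most 2n/2^k, hence is o(n/2^k) on average, while D tends to
   infinity in probability since no value of a binomial variable of large
   variance has probability bounded below.

   (ii) A class with two men and two women and cyclic preferences can be flipped
   independently of the others in a stable matching.  The number of such classes
   has mean of order n, and variance O(n) by the Efron-Stein inequality. *)

(** * Stable matchings of a two-sided market *)

Definition strict_total (T : Type) (r : rel T) :=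
  [/\ irreflexive r, transitive r & forall x y, x <> y -> r x y \/ r y x].

Lemma strict_total_asym (T : Type) (r : rel T) x y :
  strict_total r -> r x y -> r y x -> False.
Proof. by case=> irr tr _ xy yx; have := tr _ _ _ xy yx; rewrite irr. Qed.

(** The witness is an element of [P] with the fewest elements preferred to it: a better one would by
    transitivity have fewer. *)
Lemma best_exists (T : finType) (r : rel T) (P : T -> Prop) :
  strict_total r -> (exists x, P x) ->
  exists2 x, P x & forall y, P y -> y = x \/ r x y.
Proof.
move=> [irr tr tot] [x0 Px0].
have Px0' : `[< P x0 >] by apply/asboolP.
case: (@arg_minnP _ x0 (fun x => `[< P x >]) (fun x => #|[set y | r y x]%SET|) Px0')
  => x /asboolP Px minx.
exists x => // y Py; have [->|nyx] := eqVneq y x; first by left.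
right; case: (tot _ _ (elimN eqP nyx)) => // ryx.
have := minx y (introT (asboolP _) Py); rewrite leqNgt => /negP[].
apply: proper_card; apply/properP; split.
  by apply/fintype.subsetP => z; rewrite !inE => /tr; apply.
by exists y; rewrite !inE ?irr.
Qed.

Section Market.
Variables (TM TW : finType).
Implicit Types (acc mu nu : TM -> TW -> Prop) (pm : TM -> rel TW) (pw : TW -> rel TM).

(** Vacuous when [m] has no partner, so being unmatched counts as worst without a separate case. *)
Definition above pm mu m w := forall w2, mu m w2 -> pm m w w2.

(* Matchings are relations, and pairs outside [acc] may neither be matched nor
   block; truncating preference lists amounts to shrinking [acc]. *)
Definition stab acc pm pw mu := [/\ forall m w, mu m w -> acc m w,
  forall m w w', mu m w -> mu m w' -> w = w',
  forall m m' w, mu m w -> mu m' w -> m = m' &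
  forall m w, acc m w -> above pm mu m w ->
    (forall m2, mu m2 w -> pw w m m2) -> False].

(* Rejections made during men-proposing deferred acceptance, as a least fixed
   point, so that the order in which proposals are made never matters. *)
Inductive rej acc pm pw : TM -> TW -> Prop :=
| rej_acc m w : ~ acc m w -> rej acc pm pw m w
| rej_better m m' w : acc m' w -> pw w m' m ->
    (forall w', pm m' w' w -> rej acc pm pw m' w') -> rej acc pm pw m w.

(** In deferred acceptance, [m] proposes to [w] once every woman he prefers has rejected him;
    [manopt] keeps the proposals that are never rejected. *)
Definition prop acc pm pw m w :=
  acc m w /\ forall w', pm m w' w -> rej acc pm pw m w'.

Definition manopt acc pm pw m w := prop acc pm pw m w /\ ~ rej acc pm pw m w.

Definition has_woman mu m := exists w, mu m w.
Definition has_man mu w := exists m, mu m w.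

Section Fixed.
Variables (acc : TM -> TW -> Prop) (pm : TM -> rel TW) (pw : TW -> rel TM).
Hypotheses (hpm : forall m, strict_total (pm m)) (hpw : forall w, strict_total (pw w)).
Local Notation rej := (rej acc pm pw).
Local Notation prop := (prop acc pm pw).
Local Notation mu0 := (manopt acc pm pw).

Lemma not_rejP m w : ~ rej m w -> exists2 w', mu0 m w' & w = w' \/ pm m w' w.
Proof.
move=> nr; have [w' nr' best] := @best_exists _ _ (fun w => ~ rej m w) (hpm m)
  (ex_intro _ w nr).
exists w'; last exact: best.
split=> //; split=> [|w2 w2w']; first by apply: contrapT => /rej_acc.
apply: contrapT => /best [w2E|w'w2].
  by case: (hpm m) => irr _ _; move: w2w'; rewrite w2E irr.
exact: strict_total_asym w2w' w'w2.
Qed.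

(** The best man who proposes to [w] is kept, as a rejection by [w] requires a better proposer. *)
Lemma propP m w : prop m w -> exists2 m', mu0 m' w & m = m' \/ pw w m' m.
Proof.
move=> pr; have [m' pr' best] := @best_exists _ _ (fun m => prop m w) (hpw w)
  (ex_intro _ m pr).
exists m'; last exact: best.
split=> // r'.
case: r' pr' best => [m2 w2 nacc [/nacc]//|m2 m3 w2 acc3 b3 r3 _ best].
have [E|b] := best m3 (conj acc3 r3).
  by case: (hpw w2) => irr _ _; move: b3; rewrite E irr.
exact: strict_total_asym b3 b.
Qed.

Lemma rejP m w : rej m w -> acc m w -> exists2 m', mu0 m' w & pw w m' m.
Proof.
case=> {m w} [m w + /[dup] //|m m' w acc' b r _].
have [m2 mu2 [m'E|b2]] := @propP m' w (conj acc' r); exists m2 => //.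
  by rewrite -m'E.
by case: (hpw w) => _ tr _; exact: tr b2 b.
Qed.

Lemma above_manopt_rej m w : above pm mu0 m w -> rej m w.
Proof.
move=> ab; apply: contrapT => /not_rejP[w' /ab ww' [wE|w'w]].
  by case: (hpm m) => irr _ _; move: ww'; rewrite wE irr.
exact: strict_total_asym ww' w'w.
Qed.

Lemma manopt_weakly_above m w w' : prop m w -> mu0 m w' -> w = w' \/ pm m w w'.
Proof.
move=> [_ pr] [_ nr]; case: (hpm m) => _ _ tot.
have [->|/eqP/tot[|/pr//]] := eqVneq w w'; [by left|by right].
Qed.

Lemma manopt_stab : stab acc pm pw mu0.
Proof.
split=> [m w [[]]//|m w w' [pr nr] mu'|m m' w [[a r] nr] [[a' r'] nr']|m w a ab b].
- case: (manopt_weakly_above pr mu') => // ww'.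
  by case: mu' => -[_ /(_ _ ww')].
- case: (hpw w) => _ _ tot; have [//|/eqP/tot[bb|bb]] := eqVneq m m'.
    by case: nr'; exact: rej_better bb r.
  by case: nr; exact: rej_better bb r'.
- have /rejP-/(_ a)[m' mu' b'] := above_manopt_rej ab.
  exact: strict_total_asym b' (b _ mu').
Qed.

(** Induction on rejections. If [w] rejects her partner [m] for [m'], the women whom [m'] prefers to
    [w] reject him and by induction are not his partners, so [m'] and [w] block [mu]. *)
Lemma stab_not_rej mu m w : stab acc pm pw mu -> mu m w -> ~ rej m w.
Proof.
move=> [mua f1 f2 nb] mumw r; move: mumw.
elim: r => {m w} [m w na /mua//|m m' w a' b r IH mumw].
apply: (nb m' w a') => [w2 mu2|m2 mu2]; last by rewrite (f2 _ _ _ mu2 mumw).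
case: (hpm m') => _ _ tot; have [ww2|/eqP/tot[//|w2w]] := eqVneq w w2.
  move: mu2 b; rewrite -ww2 => /f2/(_ mumw) ->.
  by case: (hpw w) => ->.
by case: (IH _ w2w mu2).
Qed.

Lemma stab_weakly_below mu m w :
  stab acc pm pw mu -> mu m w -> exists2 w', mu0 m w' & w = w' \/ pm m w' w.
Proof. by move=> st mumw; apply: not_rejP; exact: stab_not_rej st mumw. Qed.

(** Stable partners are never rejected, so the certificate makes the partner of [m] under [nu] his
    best woman not rejecting him, which is the one that [manopt] selects. *)
Lemma manopt_unique nu : stab acc pm pw nu ->
  (forall m w, above pm nu m w -> rej m w) ->
  forall m w, nu m w <-> mu0 m w.
Proof.
move=> st cert m w; have nr := stab_not_rej st; split=> [numw|mumw].
  split; last exact: nr numw.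
  case: st => nua f1 _ _; split=> [|w' w'w]; first exact: nua.
  by apply: cert => w2 /f1 /(_ numw) ->.
case: mumw => -[a pr] nrm.
have [w2 nu2 npm] : exists2 w2, nu m w2 & ~ pm m w w2.
  apply: contrapT => H; apply: nrm; apply: cert => w2 nu2.
  by apply: contrapT => npm; apply: H; exists w2.
case: (hpm m) => _ _ tot; have [->//|/eqP/tot[//|w2w]] := eqVneq w w2.
by case: (nr _ _ nu2); exact: pr.
Qed.

(** Left single by [mu], [w] would block it with her men-optimal partner, since no man does better
    in [mu] than in the men-optimal matching. *)
Lemma manopt_has_man mu w : stab acc pm pw mu -> has_man mu0 w -> has_man mu w.
Proof.
move=> st [m mumw]; apply: contrapT => nh.
have muN m2 : ~ mu m2 w by move=> mu2; apply: nh; exists m2.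
have a : acc m w by case: mumw => -[].
case: (st) => _ _ _ /(_ m w a); apply => [w2 mu2|m2 /muN//].
have [w' mu' bb] := stab_weakly_below st mu2.
have [_ f1 _ _] := manopt_stab; move: bb; rewrite (f1 _ _ _ mu' mumw).
by case=> // w2E; case: (muN m); rewrite -w2E.
Qed.

Lemma stab_has_woman mu m : stab acc pm pw mu -> has_woman mu m -> has_woman mu0 m.
Proof.
by move=> st [w mumw]; have [w' mu' _] := stab_weakly_below st mumw; exists w'.
Qed.

Lemma card_matched mu : stab acc pm pw mu ->
  #|[set m : TM | `[< has_woman mu m >]]| = #|[set w : TW | `[< has_man mu w >]]|.
Proof.
move=> [_ f1 f2 _]; pose f m := [pick w | `[< mu m w >]].
have fP m w : mu m w -> f m = Some w.
  rewrite /f => mumw; case: pickP => [w' /asboolP mu'|/(_ w)/asboolP//].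
  by rewrite (f1 _ _ _ mumw mu').
have : f @: [set m : TM | `[< has_woman mu m >]] = Some @: [set w : TW | `[< has_man mu w >]].
  apply/setP => -[w|]; apply/imsetP/imsetP => -[].
  - move=> m; rewrite inE => /asboolP[w' mu']; rewrite (fP _ _ mu') => -[->].
    by exists w' => //; rewrite inE; apply/asboolP; exists m.
  - move=> w'; rewrite inE => /asboolP[m mu'] [->]; exists m; last by rewrite (fP _ _ mu').
    by rewrite inE; apply/asboolP; exists w'.
  - by move=> m; rewrite inE => /asboolP[w' mu']; rewrite (fP _ _ mu').
  - by [].
move=> E; rewrite -[RHS](card_imset _ Some_inj) -E card_in_imset // => m m'.
rewrite !inE => -[w mu1] [w' mu2].
by rewrite (fP _ _ mu1) (fP _ _ mu2) => -[wE]; apply: (f2 _ _ _ mu1); rewrite wE.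
Qed.

(** The rural hospitals theorem. Men matched by [mu] are matched by the men-optimal matching, women
    the other way round, and a matching covers as many men as women, so both inclusions are
    equalities. *)
Lemma rural_women mu w : stab acc pm pw mu -> has_man mu w <-> has_man mu0 w.
Proof.
move=> st; split=> [hw|]; last exact: manopt_has_man.
have sub : [set w : TW | `[< has_man mu0 w >]] \subset [set w : TW | `[< has_man mu w >]].
  by apply/fintype.subsetP => w'; rewrite !inE; exact: manopt_has_man.
have : [set w : TW | `[< has_man mu0 w >]] = [set w : TW | `[< has_man mu w >]].
  apply/eqP; rewrite eqEcard sub -(card_matched st) -(card_matched manopt_stab).
  apply: subset_leq_card; apply/fintype.subsetP => m.
  by rewrite !inE; exact: stab_has_woman.
by move=> /setP/(_ w); rewrite !inE => E; apply/asboolP; rewrite E; apply/asboolP.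
Qed.

Lemma rural_men mu m : stab acc pm pw mu -> has_woman mu m <-> has_woman mu0 m.
Proof.
move=> st; split=> [|hw]; first exact: stab_has_woman.
have sub : [set m : TM | `[< has_woman mu m >]] \subset [set m : TM | `[< has_woman mu0 m >]].
  by apply/fintype.subsetP => m'; rewrite !inE; exact: stab_has_woman.
have : [set m : TM | `[< has_woman mu m >]] = [set m : TM | `[< has_woman mu0 m >]].
  apply/eqP; rewrite eqEcard sub (card_matched st) (card_matched manopt_stab).
  apply: subset_leq_card; apply/fintype.subsetP => w.
  by rewrite !inE; exact: manopt_has_man.
by move=> /setP/(_ m); rewrite !inE => E; apply/asboolP; rewrite E; apply/asboolP.
Qed.

End Fixed.
End Market.

(** * Exchanging two entries of a preference list *)

(* Deferred acceptance only reads the lists down to the partner obtained; the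
   women in [Z] refuse everybody in the second market. *)
Lemma manopt_transfer (TM TW : finType) (acc acc' : TM -> TW -> Prop)
    (pm pm' : TM -> rel TW) (pw : TW -> rel TM) (Z : TW -> Prop)
    (nu' : TM -> TW -> Prop) :
  (forall m, strict_total (pm m)) -> (forall m, strict_total (pm' m)) ->
  (forall w, strict_total (pw w)) ->
  (forall m w, nu' m w -> acc' m w) ->
  (forall m w w', nu' m w -> nu' m w' -> w = w') ->
  (forall m m' w, nu' m w -> nu' m' w -> m = m') ->
  (forall m w, ~ Z w -> acc m w <-> acc' m w) ->
  (forall m w, acc' m w -> ~ Z w) ->
  (forall m w, ~ Z w -> manopt acc pm pw m w -> nu' m w) ->
  (forall m w, ~ Z w -> above pm' nu' m w -> above pm (manopt acc pm pw) m w) ->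
  (forall m w w', ~ Z w -> ~ Z w' ->
     (forall w2, manopt acc pm pw m w2 -> w = w2 \/ pm m w w2) ->
     pm' m w' w -> pm m w' w) ->
  forall m w, nu' m w <-> manopt acc' pm' pw m w.
Proof.
move=> hpm hpm' hpw sub f1 f2 ha hz h1 h2 h3.
(* Rejections carry over by induction: [w] is weakly above the partner of the man [m'] who displaces
   [m], so by [h3] the women ranked before [w] in his second list were ranked before her in the
   first, where they rejected him. *)
have step m w : rej acc pm pw m w -> above pm (manopt acc pm pw) m w ->
    rej acc' pm' pw m w.
  elim=> {m w} [m w na _|m m' w a b r IH _].
    have [Zw|nZ] := pselect (Z w); first by apply: rej_acc => /hz.
    by apply: rej_acc => /(ha m w nZ).
  have [Zw|nZ] := pselect (Z w); first by apply: rej_acc => /hz.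
  apply: (@rej_better _ _ _ _ _ _ m') => [||w' w'w]; [exact/(ha _ _ nZ)|exact: b|].
  have [Zw'|nZ'] := pselect (Z w'); first by apply: rej_acc => /hz.
  have wab w2 : manopt acc pm pw m' w2 -> w = w2 \/ pm m' w w2.
    exact: manopt_weakly_above.
  have w'w2 := h3 _ _ _ nZ nZ' wab w'w.
  apply: IH => // w2 /wab[<-//|]; by case: (hpm m') => _ tr _; exact: tr.
have ab m w : ~ Z w -> above pm' nu' m w -> rej acc pm pw m w.
  by move=> nZ /(h2 _ _ nZ)/(above_manopt_rej hpm).
apply: manopt_unique => //; last first.
  move=> m w abw; have [Zw|nZ] := pselect (Z w); first by apply: rej_acc => /hz.
  by apply: step; [exact: ab|exact: h2].
split=> // m w a abw bw; have nZ := hz _ _ a.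
have [m' mu' b'] := rejP hpw (ab _ _ nZ abw) (proj2 (ha m w nZ) a).
exact: strict_total_asym (hpw w) b' (bw _ (h1 _ _ nZ mu')).
Qed.

Section Lists.
Variable n : nat.
Implicit Types (s : {ffun 'I_n -> {perm 'I_n}}) (A B : {set 'I_n}).

Definition list_pref s (x : 'I_n) : rel 'I_n := fun y z => (s x y < s x z)%N.

Lemma list_pref_strict s x : strict_total (list_pref s x).
Proof.
split=> [y|y z t|y z yz]; rewrite /list_pref ?ltnn //; first exact: ltn_trans.
apply/orP; rewrite -neq_ltn; apply/eqP => /val_inj/perm_inj.
exact: yz.
Qed.
Hint Resolve list_pref_strict : core.

Definition class_acc A B (m w : 'I_n) := m \in A /\ w \in B.

Definition multi_woman A B s t w := exists mu mu' m m',
  [/\ stab (class_acc A B) (list_pref s) (list_pref t) mu,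
      stab (class_acc A B) (list_pref s) (list_pref t) mu',
      mu m w, mu' m' w & m <> m'].

Definition swap_list s (m w u : 'I_n) : {ffun 'I_n -> {perm 'I_n}} :=
  [ffun x => if x == m then (tperm w u * s x)%g else s x].

Lemma swap_listK s m w u : swap_list (swap_list s m w u) m w u = s.
Proof.
apply/ffunP => x; rewrite !ffunE; case: eqP => // _.
by rewrite mulgA tperm2 mul1g.
Qed.

Section Swap.
Variables (A B : {set 'I_n}) (s t : {ffun 'I_n -> {perm 'I_n}}) (w0 : 'I_n).
Local Notation acc := (class_acc A B).
Local Notation mu0 s := (manopt acc (list_pref s) (list_pref t)).
(** Two truncations of the list of [w0]. Under [acc_only m1] deferred acceptance brings [m1] to her;
    [acc_without] is the market from which an exchange is decoded. *)
Definition acc_only m1 m w := class_acc A B m w /\ (w = w0 -> m = m1).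
Definition acc_without m w := class_acc A B m w /\ w <> w0.
Local Notation mu1 m1 := (manopt (acc_only m1) (list_pref s) (list_pref t)).
Local Notation mu2 s := (manopt acc_without (list_pref s) (list_pref t)).

Variables (m1 u : 'I_n).
Hypotheses (uB : u \in B) (u_free : ~ has_man (mu0 s) u).
Variables (mu : 'I_n -> 'I_n -> Prop) (m0 : 'I_n).
Hypotheses (mu_stab : stab acc (list_pref s) (list_pref t) mu)
  (mu_m1 : mu m1 w0) (mu0_m0 : mu0 s m0 w0) (m01 : m1 <> m0).
Local Notation s' := (swap_list s m1 w0 u).

Let hs := list_pref_strict s.
Let ht := list_pref_strict t.

Lemma unmatched_neq : u <> w0.
Proof. by move=> uw; apply: u_free; rewrite uw; exists m0. Qed.

Lemma mu_stab_only : stab (acc_only m1) (list_pref s) (list_pref t) mu.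
Proof.
case: mu_stab => a f1 f2 nb; split=> // [m w mumw|m w [+ _]]; last exact: nb.
by split; [exact: a|move=> wE; move: mumw; rewrite wE => /f2/(_ mu_m1)].
Qed.

(** [w0] is matched in [mu], hence in every stable matching of the truncated market, where only [m1]
    is acceptable to her. *)
Lemma only_m1 : mu1 m1 m1 w0.
Proof.
have [m /[dup] mm [[[_ /(_ erefl) mE] _] _]] : has_man (mu1 m1) w0.
  by apply/(rural_women hs ht w0 mu_stab_only); exists m1.
by rewrite -[X in manopt _ _ _ X]mE.
Qed.

Lemma only_has_man w : has_man (mu1 m1) w -> has_man (mu0 s) w.
Proof.
move=> /(manopt_has_man hs ht mu_stab_only) hm.
exact/(rural_women hs ht w mu_stab).
Qed.

(** Rejecting somebody, [u] would hold another man, and a woman matched in the truncated market is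
    matched in the original one, which [u] is not. *)
Lemma u_not_proposed m w : mu1 m1 m w -> ~ list_pref s m u w.
Proof.
move=> [[[[mA _] _] pr] _] /pr /(rejP ht)[|m' mm' _].
  by split=> // uw; case: unmatched_neq.
by apply: u_free; apply: only_has_man; exists m'.
Qed.

Lemma u_not_proposed0 m w : mu0 s m w -> ~ list_pref s m u w.
Proof.
move=> [[[mA _] pr] _] /pr /(rejP ht)[//|m' mm' _].
by apply: u_free; exists m'.
Qed.

Lemma w0_below w : mu0 s m1 w -> list_pref s m1 w w0.
Proof.
move=> mw; have [w' mw' bb] := stab_weakly_below hs ht mu_stab mu_m1.
have [_ f1 f2 _] := manopt_stab acc hs ht.
case: bb => [wE|]; last by rewrite (f1 _ _ _ mw mw').
by case: m01; apply: (f2 _ _ w0) => //; rewrite wE.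
Qed.

Lemma new_partner_matched : exists w, mu0 s m1 w.
Proof. by apply/(rural_men hs ht m1 mu_stab); exists w0. Qed.

Lemma swap_pref_off m w w' : m <> m1 -> list_pref s' m w w' = list_pref s m w w'.
Proof. by move=> /eqP/negPf mm; rewrite /list_pref !ffunE mm. Qed.

Lemma swap_pref_on w w' :
  list_pref s' m1 w w' = list_pref s m1 (tperm w0 u w) (tperm w0 u w').
Proof. by rewrite /list_pref !ffunE eqxx !permM. Qed.

Lemma tperm_other x : x <> w0 -> x <> u -> tperm w0 u x = x.
Proof. by move=> /eqP xw /eqP xu; rewrite tpermD // eq_sym. Qed.

(** [w0] and [u] both come after the men-optimal partner of [m1] in his list, so deferred acceptance
    stops before the exchanged entries. *)
Lemma swap_manopt0 m w : mu0 s m w <-> mu0 s' m w.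
Proof.
move: m w.
have [_ f1 f2 _] := manopt_stab acc hs ht.
have irr m w : ~ list_pref s m w w by rewrite /list_pref ltnn.
have tr m : transitive (list_pref s m) by case: (hs m).
have [w1 mw1] := new_partner_matched; have w1w0 := w0_below mw1; have uw1 := u_not_proposed0 mw1.
have w1N0 : w1 <> w0 by move=> E; apply: (irr m1 w0); rewrite -{1}E.
have w1Nu : w1 <> u by move=> E; apply: u_free; exists m1; rewrite -E.
apply: (@manopt_transfer _ _ acc acc _ _ _ (fun=> False)) => //.
- by move=> m w [[]].
- by move=> m w _ [].

- move=> m w _ ab; have [mE|mN] := pselect (m = m1); last first.
    by move=> w2 /ab; rewrite swap_pref_off.
  subst m => w2 /(f1 _ _ _ mw1) <-; have := ab _ mw1; rewrite swap_pref_on.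
  rewrite (tperm_other w1N0 w1Nu).
  case: tpermP => [_ /uw1//|_|//].
  by move=> w0w1; case: (strict_total_asym (hs m1) w0w1 w1w0).
- move=> m w w' _ _ ab; have [mE|mN] := pselect (m = m1); last first.
    by rewrite swap_pref_off.
  subst m; rewrite swap_pref_on => lt.
  have lt1 w2 : list_pref s m1 w2 w -> list_pref s m1 w2 w1.
    by case: (ab _ mw1) => [->//|ww1 /tr]; apply.
  have wN0 : w <> w0.
    move=> E; case: (ab _ mw1) => [|ww1]; first by rewrite E => /esym.
    by apply: (strict_total_asym (hs m1) ww1); rewrite E.
  have wNu : w <> u.
    by move=> E; case: (ab _ mw1) => [|ww1]; [rewrite E => /esym|apply: uw1; rewrite -E].
  move: lt; rewrite (tperm_other wN0 wNu); case: tpermP => [_|_|//] /lt1 // w0w1.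
  by case: (strict_total_asym (hs m1) w0w1 w1w0).
Qed.

(** In the new list [m1] finds [u] where he found [w0]. Nobody else proposes to [u], so she keeps
    him, and the other pairs are those obtained when [w0] accepts only [m1]. *)
Lemma swap_manopt2 m w :
  (mu1 m1 m w /\ w <> w0 \/ m = m1 /\ w = u) <-> mu2 s' m w.
Proof.
move: m w.
have [sub f1 f2 _] := manopt_stab (acc_only m1) hs ht.
have irr m w : ~ list_pref s m w w by rewrite /list_pref ltnn.
have tr m : transitive (list_pref s m) by case: (hs m).
have mw0 := only_m1; have uw0 := u_not_proposed mw0; have uN0 := unmatched_neq.
have nu m : ~ mu1 m1 m u.
  by move=> mu'; apply: u_free; apply: only_has_man; exists m.
have m1A : m1 \in A by case: (sub _ _ mw0) => -[].
apply: (@manopt_transfer _ _ (acc_only m1) acc_without _ _ _ (fun w => w = w0)) => //.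
- by move=> m w [[/sub[]]|[-> ->]].
- move=> m w w' [[mw wN]|[-> ->]] [[mw' wN']|[mE ->]] //.
  + exact: f1 mw mw'.
  + by subst m; case: wN; exact: f1 mw mw0.
  + by case: wN'; exact: f1 mw' mw0.
- move=> m m' w [[mw wN]|[-> ->]] [[mw' wN']|[-> wE]] //.
  + exact: f2 mw mw'.
  + by case: (nu m); rewrite -wE.
  + by case: (nu m').
- by move=> m w wN; split=> -[? ?]; split.
- by move=> m w [].
- by move=> m w wN mw; left.
- move=> m w wN ab; have [mE|mN] := pselect (m = m1); last first.
    move=> w2 mw2; rewrite -swap_pref_off //; apply: ab; left; split=> // wE.
    by apply: mN; apply: (f2 _ _ w0) => //; rewrite -wE.
  subst m => w2 /(f1 _ _ _ mw0) <-; have := ab u (or_intror (conj erefl erefl)).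
  rewrite swap_pref_on tpermR; case: tpermP => [//|_ /irr|//]//.
- move=> m w w' wN wN' ab; have [mE|mN] := pselect (m = m1); last first.
    by rewrite swap_pref_off.
  subst m; rewrite swap_pref_on; case: (ab _ mw0) => // ww0.
  have wNu : w <> u by move=> E; apply: uw0; rewrite -E.
  rewrite (tperm_other wN wNu); case: tpermP => [//|_ w0w|//].
  by case: (strict_total_asym (hs m1) w0w ww0).
Qed.

End Swap.

Lemma card_has_man A B s t mu :
  stab (class_acc A B) (list_pref s) (list_pref t) mu ->
  (#|[set w : 'I_n | `[< has_man mu w >]]| <= #|A|)%N.
Proof.
move=> st; rewrite -(card_matched st); apply: subset_leq_card.
by apply/fintype.subsetP => m; rewrite !inE => -[w]; case: st => sub _ _ _ /sub[].
Qed.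

Lemma card_free A B s t :
  (#|B| - #|A| <= #|[set u in B | `[< ~ has_man
     (manopt (class_acc A B) (list_pref s) (list_pref t)) u >]]|)%N.
Proof.
set mu0 := manopt _ _ _; have hs := list_pref_strict s; have ht := list_pref_strict t.
have /card_has_man le := manopt_stab (class_acc A B) hs ht.
rewrite leq_subLR; apply: leq_trans (leq_add le (leqnn _)).
apply: leq_trans (leq_card_setU _ _); apply: subset_leq_card.
apply/fintype.subsetP => w wB; rewrite finset.inE.
have [h|h] := pselect (has_man mu0 w).
  by apply/orP; left; rewrite finset.inE; apply/asboolP.
by apply/orP; right; rewrite finset.inE wB; apply/asboolP.
Qed.

(* Exchanging [w0] and an unmatched woman [u] in the list of a stable partner of
   [w0] other than her men-optimal one is injective in the pair (lists, [u]):
   [u] and that man can be read off the new market, since [u] is the only woman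
   matched once [w0] refuses everybody but unmatched before. *)
Lemma card_multi_woman A B t w0 :
  (#|[set s | `[< multi_woman A B s t w0 >]]| * (#|B| - #|A|)
     <= #|{ffun 'I_n -> {perm 'I_n}}|)%N.
Proof.
have ht := list_pref_strict t.
pose mu0 s := manopt (class_acc A B) (list_pref s) (list_pref t).
pose good s m1 := exists mu m0,
  [/\ stab (class_acc A B) (list_pref s) (list_pref t) mu, mu m1 w0, mu0 s m0 w0 & m1 <> m0].
(* [g s] is a stable partner of [w0] other than the men-optimal one: of two different stable
   partners, at least one is not men-optimal. Where there is no such partner the value [w0] is
   arbitrary. *)
have /boolp.choice[g gP] s : exists m1, multi_woman A B s t w0 -> good s m1.
  have [mw|nmw] := pselect (multi_woman A B s t w0); last by exists w0.
  have hs := list_pref_strict s.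
  have [mu [mu' [m [m' [st st' mm mm' neq]]]]] := mw.
  have [m0 h0] : has_man (mu0 s) w0 by apply/(rural_women hs ht w0 st); exists m.
  have [mE|mN] := eqVneq m m0.
    by exists m' => _; exists mu', m0; split=> // E; apply: neq; rewrite mE.
  by exists m => _; exists mu, m0; split=> //; apply/eqP.
pose fr s := [set u in B | `[< ~ has_man (mu0 s) u >]].
pose P := [set p : {ffun 'I_n -> {perm 'I_n}} * 'I_n |
  `[< multi_woman A B p.1 t w0 >] & p.2 \in fr p.1].
pose Phi (p : {ffun 'I_n -> {perm 'I_n}} * 'I_n) := swap_list p.1 (g p.1) w0 p.2.
have Phi_inj : {in P &, injective Phi}.
  move=> [s u] [s' u']; rewrite !finset.inE /= => /andP[/asboolP mw /andP[uB /asboolP uf]].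
  move=> /andP[/asboolP mw' /andP[uB' /asboolP uf']]; rewrite /Phi /= => E.
  have [mu [m0 [st mm m00 neq]]] := gP _ mw.
  have [mu' [m0' [st' mm' m00' neq']]] := gP _ mw'.
  have E2 := swap_manopt2 uB uf st mm m00.
  have E2' := swap_manopt2 uB' uf' st' mm' m00'.
  have E0 := swap_manopt0 uB uf st mm m00 neq.
  have E0' := swap_manopt0 uB' uf' st' mm' m00' neq'.
  have := proj1 (E2 (g s) u) (or_intror (conj erefl erefl)).
  (* Read in the other decomposition, the pair of [g s] and [u] either is its exchanged pair, and
     undoing the exchange gives equal lists, or comes from the truncated market, and then [u] was
     matched before the exchange. *)
  rewrite E => /E2'[[mu1 _]|[gE uE]]; last first.
    by rewrite -(swap_listK s (g s) w0 u) E gE uE swap_listK.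
  have [|m] := only_has_man st' mm' (w := u); first by exists (g s).
  by move=> /E0'; rewrite -E => /E0 m0u; case: uf; exists m.
have : (#|P| <= #|{ffun 'I_n -> {perm 'I_n}}|)%N.
  by rewrite -(card_in_imset Phi_inj) max_card.
apply: leq_trans.
have -> : #|P| = (\sum_(s in [set s | `[< multi_woman A B s t w0 >]]) #|fr s|)%N.
  under eq_bigr do rewrite -sum1_card.
  by rewrite pair_big_dep -sum1_card; apply: eq_bigl => p; rewrite !finset.inE.
rewrite -sum_nat_const; apply: leq_sum => s _; exact: card_free.
Qed.

End Lists.

(** * Classes *)

Section ClassMarket.
Variable n : nat.
Implicit Types (s t : {ffun 'I_n -> {perm 'I_n}}) (A B : {set 'I_n}).

Definition class_stab A B s t := stab (class_acc A B) (list_pref s) (list_pref t).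

Lemma class_stab_swap A B s t mu :
  class_stab A B s t mu -> class_stab B A t s (fun w m => mu m w).
Proof.
case=> sub f1 f2 nb; split=> [w m /sub[]|w m m'|w w' m|w m [wB mA] ab1 ab2] //.
- exact: f2.
- exact: f1.
- exact: (nb m w).
Qed.

(** Whoever has several stable partners in the whole market either has two inside the class or is,
    in some stable matching, not matched inside it. *)
Definition varying_woman A B s t w := multi_woman A B s t w \/
  exists2 mu, class_stab A B s t mu & ~ has_man mu w.

(* The men of a class are handled as the women of the mirrored market. *)
Definition n_varying A B s t :=
  (#|[set w in B | `[< varying_woman A B s t w >]]| +
   #|[set m in A | `[< varying_woman B A t s m >]]|)%N.

Definition n_multi_women A B s t := #|[set w in B | `[< multi_woman A B s t w >]]|.

Lemma n_varying_swap A B s t : n_varying A B s t = n_varying B A t s.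
Proof. exact: addnC. Qed.

(** A single man would block with any single woman, so if one man is left over, all of [B] is
    matched to the at most [#|A| - 1] other men. *)
Lemma class_men_matched A B s t mu m : class_stab A B s t mu -> (#|A| <= #|B|)%N ->
  m \in A -> has_woman mu m.
Proof.
move=> st le mA; apply: contrapT => nh.
have hB w : w \in B -> has_man mu w.
  move=> wB; apply: contrapT => nw; case: (st) => _ _ _ /(_ m w); apply=> //.
    by move=> w2 mw2; case: nh; exists w2.
  by move=> m2 mw2; case: nw; exists m2.
have : (#|B| <= #|A :\ m|)%N.
  apply: (@leq_trans #|[set w : 'I_n | `[< has_man mu w >]]|).
    by apply/subset_leq_card/fintype.subsetP => w /hB h; rewrite finset.inE; apply/asboolP.
  rewrite -(card_matched st); apply/subset_leq_card/fintype.subsetP => m'.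
  rewrite finset.inE => /asboolP[w mw]; rewrite finset.in_setD1.
  have -> : m' \in A by case: st => /(_ _ _ mw)[].
  by rewrite andbT; apply/eqP => mE; apply: nh; exists w; rewrite -mE.
rewrite leqNgt => /negP[]; by rewrite (leq_trans _ le) // [X in (_ < X)%N](cardsD1 m A) mA.
Qed.

(** The men-optimal matching covers at least [#|A|] women, and these are matched in every stable
    matching; at most [#|B| - #|A|] are ever single. *)
Lemma varying_women_le A B s t : (#|A| <= #|B|)%N ->
  (#|[set w in B | `[< varying_woman A B s t w >]]|
     <= n_multi_women A B s t + (#|B| - #|A|))%N.
Proof.
move=> le; have hs := list_pref_strict s; have ht := list_pref_strict t.
have st0 : class_stab A B s t _ := manopt_stab (class_acc A B) hs ht.
move: st0; set mu0 := manopt _ _ _ => st0.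
pose matched := [set w : 'I_n | `[< has_man mu0 w >]].
have matchedB : matched \subset B.
  apply/fintype.subsetP => w; rewrite finset.inE => /asboolP[m].
  by case: st0 => sub _ _ _ /sub[].
have leA : (#|A| <= #|matched|)%N.
  rewrite /matched -(card_matched st0); apply/subset_leq_card/fintype.subsetP => m mA.
  by rewrite finset.inE; apply/asboolP; apply: class_men_matched st0 le mA.
apply: (@leq_trans (n_multi_women A B s t + #|B :\: matched|)).
  apply: leq_trans (leq_card_setU _ _); apply/subset_leq_card/fintype.subsetP => w.
  rewrite !finset.inE => /andP[wB /asboolP[mw|[mu st nm]]]; rewrite wB ?andbT.
    by apply/orP; left; apply/asboolP.
  by apply/orP; right; apply/asboolP => hm; apply: nm; apply: (manopt_has_man hs ht st).
by rewrite leq_add2l cardsD (finset.setIidPr matchedB) leq_sub2l.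
Qed.

(** On the shorter side a man is always matched, so he varies only by having two partners. His
    men-optimal partner then has another man in some stable matching, and different men give
    different women. *)
Lemma varying_men_le A B s t : (#|A| <= #|B|)%N ->
  (#|[set m in A | `[< varying_woman B A t s m >]]| <= n_multi_women A B s t)%N.
Proof.
move=> le; have hs := list_pref_strict s; have ht := list_pref_strict t.
have st0 : class_stab A B s t _ := manopt_stab (class_acc A B) hs ht.
move: st0; set mu0 := manopt _ _ _ => st0.
have /boolp.choice[f fP] m : exists w, m \in [set m in A | `[< varying_woman B A t s m >]] ->
    [/\ mu0 m w, w \in B & multi_woman A B s t w].
  have [|nv] := boolP (m \in _); last by exists m.
  rewrite finset.inE => /andP[mA /asboolP[|[mu /class_stab_swap st nh]]]; last first.
    by case: nh; apply: class_men_matched st le mA.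
  move=> [mu [mu' [w [w' [/class_stab_swap st /class_stab_swap st' mw mw' neq]]]]].
  have [w0 mw0] := class_men_matched st0 le mA; exists w0 => _.
  split=> //; first by case: st0 => /(_ _ _ mw0)[].
  wlog wN : mu mu' w w' st st' mw mw' neq / w <> w0.
    move=> H; have [wE|/eqP wN] := eqVneq w w0; last exact: (H mu mu' w w').
    by apply: (H mu' mu w' w) => // [/esym//|w'E]; apply: neq; rewrite wE.
  have [m' m'w0] : has_man (fun m w => mu w m) w0.
    by apply: (manopt_has_man hs ht st); exists m.
  exists mu0, (fun m w => mu w m), m, m'; split=> // mE.
  by case: st => _ f1 _ _; apply: wN; apply: (f1 m) => //; rewrite mE.
have f_inj : {in [set m in A | `[< varying_woman B A t s m >]] &, injective f}.
  move=> m m' /fP[mw _ _] /fP[mw' _ _] E; case: st0 => _ _ f2 _.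
  by apply: (f2 _ _ _ mw); rewrite E.
rewrite -(card_in_imset f_inj); apply/subset_leq_card/fintype.subsetP => w /imsetP[m /fP[_ wB mw] ->].
by rewrite finset.inE wB; apply/asboolP.
Qed.

Lemma n_varying_le A B s t : (#|A| <= #|B|)%N ->
  (n_varying A B s t <= (n_multi_women A B s t).*2 + (#|B| - #|A|))%N.
Proof.
move=> le; rewrite -addnn addnAC; apply: leq_add; first exact: varying_women_le.
exact: varying_men_le.
Qed.

Local Notation lists := {ffun 'I_n -> {perm 'I_n}}.

Lemma sum_multi_women A B t : (\sum_(s : lists) n_multi_women A B s t =
  \sum_(w in B) #|[set s : lists | `[< multi_woman A B s t w >]]|)%N.
Proof.
rewrite [LHS](eq_bigr (fun s => \sum_(w in [set w in B | `[< multi_woman A B s t w >]]) 1)%N); last by move=> s _; rewrite sum1_card.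
rewrite [RHS](eq_bigr (fun w => \sum_(s in [set s : lists | `[< multi_woman A B s t w >]]) 1)%N); last by move=> w _; rewrite sum1_card.

rewrite (exchange_big_dep (mem B)) /= => [|s w _]; last by rewrite finset.inE => /andP[].
apply: eq_bigr => w wB; apply: eq_bigl => s; by rewrite !finset.inE wB.
Qed.

Lemma sum_n_varying_aux A B : (#|A| <= #|B|)%N ->
  ((#|B| - #|A|).+1 * \sum_(s : lists) \sum_(t : lists) n_varying A B s t <=
   (4 * (#|A| + #|B|) + (#|B| - #|A|) * (#|B| - #|A|).+1) * #|{: lists}| ^ 2)%N.
Proof.
move=> le; set D := (#|B| - #|A|)%N; set T := #|{: lists}|.
have one t : (D.+1 * \sum_(s : lists) n_multi_women A B s t <= 2 * #|B| * T)%N.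
  rewrite sum_multi_women big_distrr /= [X in (_ <= X)%N](_ : _ = \sum_(w in B) 2 * T)%N; last first.
    by rewrite sum_nat_const mulnCA mulnA.
  (* [D] times the count is at most [T]; adding the trivial bound [T] on the count gives the factor
     [D.+1], which also covers [D = 0]. *)
  apply: leq_sum => w _; have := card_multi_woman A B t w.
  rewrite -/D -/T; have : (#|[set s : lists | `[< multi_woman A B s t w >]]| <= T)%N.
    exact: max_card.
  move: #|_| => x; rewrite mulSn mulnC => xT xD.
  by rewrite mul2n -addnn leq_add // mulnC.
rewrite exchange_big /= (leq_trans (n := \sum_(t : lists) (4 * #|B| + D * D.+1) * T)%N) //.
  rewrite big_distrr /=; apply: leq_sum => t _.
  apply: (@leq_trans (D.+1 * \sum_(s : lists) ((n_multi_women A B s t).*2 + D))%N).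
    by rewrite leq_mul2l; apply/orP; right; apply: leq_sum => s _; apply: n_varying_le.
  rewrite big_split /= sum_nat_const -/T mulnDr mulnDl leq_add //; last first.
    by rewrite mulnCA mulnC [(D.+1 * D)%N]mulnC.
  under eq_bigr do rewrite -mul2n.
  rewrite -big_distrr /= mulnCA -[4%N]/(2 * 2)%N -!mulnA leq_mul2l /=.
  by rewrite mulnA; apply: one.
rewrite sum_nat_const -/T mulnCA expnS expn1 leq_mul2r.
by rewrite leq_add2r leq_mul2l leq_addl !orbT.
Qed.

Definition gap x y := ((x - y) + (y - x))%N.

Lemma sum_n_varying A B :
  ((gap #|A| #|B|).+1 * \sum_(s : lists) \sum_(t : lists) n_varying A B s t <=
   (4 * (#|A| + #|B|) + gap #|A| #|B| * (gap #|A| #|B|).+1) * #|{: lists}| ^ 2)%N.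
Proof.
case: (leqP #|A| #|B|) => [le|/ltnW le].
  by rewrite /gap (eqP le) add0n; apply: sum_n_varying_aux.
rewrite /gap (eqP le) addn0 exchange_big /= [(#|A| + _)%N]addnC.
under eq_bigr do under eq_bigr do rewrite n_varying_swap.
exact: sum_n_varying_aux.
Qed.

End ClassMarket.

(** * Restriction of global stable matchings to classes *)

Section Global.
Variables (R : realType) (n k : nat) (d : profile k -> profile k -> R)
  (hd : is_metric d).
Implicit Types (o : outcome n k) (M : matching_fun n) (a : profile k).

Definition class_of (p : {ffun 'I_n -> profile k}) a := [set i | p i == a].

Lemma dist_refl x : d x x = 0%R.
Proof. by case: hd => _ /(_ x x)[_ ->]. Qed.

Lemma dist_gt0 x y : x != y -> (0 < d x y)%R.
Proof.
move=> xy; case: hd => /(_ x y) ge0 /(_ x y)[d0 _] _ _.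
by rewrite lt_neqAle ge0 andbT eq_sym; apply: contra xy => /eqP/d0/eqP.
Qed.

Lemma man_prefers_strict o m : strict_total (man_prefers d o m).
Proof.
rewrite /man_prefers; split=> [w|w2 w1 w3|w1 w2 neq] /=.
- by rewrite ltxx ltnn andbF.
- case/orP=> [l12|/andP[/eqP-> t12]]; case/orP=> [l23|/andP[/eqP e23 t23]].
  + by rewrite (lt_trans l12 l23).
  + by rewrite -e23 l12.
  + by rewrite l23.
  + by rewrite e23 eqxx (ltn_trans t12 t23) orbT.
- have tN : tb_man o m w1 != tb_man o m w2 :> nat.
    by apply/eqP => /val_inj/perm_inj.
  case: ltgtP => [_|_|_] /=; [by left|by right|].
  by case: ltngtP tN => //= _ _; [left|right].
Qed.

Lemma woman_prefers_strict o w : strict_total (woman_prefers d o w).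
Proof.
rewrite /woman_prefers; split=> [m|m2 m1 m3|m1 m2 neq] /=.
- by rewrite ltxx ltnn andbF.
- case/orP=> [l12|/andP[/eqP-> t12]]; case/orP=> [l23|/andP[/eqP e23 t23]].
  + by rewrite (lt_trans l12 l23).
  + by rewrite -e23 l12.
  + by rewrite l23.
  + by rewrite e23 eqxx (ltn_trans t12 t23) orbT.
- have tN : tb_woman o w m1 != tb_woman o w m2 :> nat.
    by apply/eqP => /val_inj/perm_inj.
  case: ltgtP => [_|_|_] /=; [by left|by right|].
  by case: ltngtP tN => //= _ _; [left|right].
Qed.

Definition global_stab o := stab (fun _ _ => True) (man_prefers d o) (woman_prefers d o).

Lemma stableP o M : stable d o M <-> global_stab o (fun m w => M m = Some w).
Proof.
split=> [/andP[/forallP mat /forallP nb]|[_ _ f2 nb]].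
  split=> // [m w w' -> []//|m m' w mw mw'|m w _ ab1 ab2].
    have /forallP/(_ m') := mat m; rewrite mw mw' /= eqxx /=; by move/eqP.
  have /forallP/(_ w) := nb m; apply/negP; rewrite negbK /blocking /man_improves.
  apply/and3P; split.
  - apply/eqP => mw; have := ab1 _ mw.
    by case: (man_prefers_strict o m) => ->.
  - by case E: (M m) => [w'|//]; apply: ab1.
  - by apply/forallP => m'; apply/implyP => /eqP/ab2.
apply/andP; split.
  apply/forallP => m; apply/forallP => m'; apply/implyP; case E: (M m) => [w|//] _.
  by apply/implyP => /eqP/esym E'; apply/eqP/f2; [exact: E|].
apply/forallP => m; apply/forallP => w; apply/negP => /and3P[mw im iw].
apply: (nb m w) => // [w2 mw2|m2 mw2]; first by move: im; rewrite /man_improves mw2.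
by move/forallP: iw => /(_ m2); rewrite mw2 eqxx.
Qed.

Definition in_class o M a m w :=
  [/\ M m = Some w, m \in class_of o.1.1.1 a & w \in class_of o.1.1.2 a].

(** Partners outside the class are at positive distance and members at distance zero, so a pair
    blocking inside the class would block [M]. *)
Lemma in_class_stab o M a : stable d o M ->
  class_stab (class_of o.1.1.1 a) (class_of o.1.1.2 a) o.1.2 o.2 (in_class o M a).
Proof.
move=> /stableP[_ f1 f2 nb]; split.
- by move=> m w [].
- by move=> m w w' [h _ _] [h' _ _]; apply: f1 h h'.
- by move=> m m' w [h _ _] [h' _ _]; apply: f2 h h'.
- move=> m w [mA wB] ab1 ab2; apply: (nb m w) => // [w2 mw2|m2 mw2].
    have [w2B|w2NB] := boolP (w2 \in class_of o.1.1.2 a).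
      move: (ab1 w2 (And3 mw2 mA w2B)); move: mA wB w2B; rewrite !finset.inE.
      rewrite /man_prefers /prof_man /prof_woman => /eqP-> /eqP-> /eqP-> lt.
      by apply/orP; right; rewrite eqxx.
    move: mA wB w2NB; rewrite !finset.inE /man_prefers /prof_man /prof_woman.
    move=> /eqP-> /eqP-> neq; apply/orP; left.
    by rewrite dist_refl dist_gt0 // eq_sym.
  have [m2A|m2NA] := boolP (m2 \in class_of o.1.1.1 a).
    move: (ab2 m2 (And3 mw2 m2A wB)); move: mA wB m2A; rewrite !finset.inE.
    rewrite /woman_prefers /prof_man /prof_woman => /eqP-> /eqP-> /eqP-> lt.
    by apply/orP; right; rewrite eqxx.
  move: mA wB m2NA; rewrite !finset.inE /woman_prefers /prof_man /prof_woman.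
  move=> /eqP-> /eqP-> neq; apply/orP; left.
  by rewrite dist_refl dist_gt0 // eq_sym.
Qed.

Lemma two_elements (T : finType) (X : {set T}) : (1 < #|X|)%N ->
  exists x y, [/\ x \in X, y \in X & x <> y].
Proof.
move=> /card_gt1P[x [y [xX yX xy]]]; exists x, y; split=> //; exact/eqP.
Qed.

(** If both partners lie in the class of [w], they are stable partners there; a matching that gives
    an outside partner leaves [w] single in the class. *)
Lemma multi_varying_woman o w : (1 < n_stable_partners_woman d o w)%N ->
  varying_woman (class_of o.1.1.1 (o.1.1.2 w)) (class_of o.1.1.2 (o.1.1.2 w)) o.1.2 o.2 w.
Proof.
move=> /two_elements[m [m' []]]; rewrite !finset.inE.
move=> /existsP[M /andP[st /eqP mw]] /existsP[M' /andP[st' /eqP mw']] neq.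
set a := o.1.1.2 w.
have wB : w \in class_of o.1.1.2 a by rewrite finset.inE.
have [mA|mNA] := boolP (m \in class_of o.1.1.1 a); last first.
  right; exists (in_class o M a); first exact: in_class_stab.
  move=> [m2 [mw2 m2A _]]; move: st => /stableP[_ _ f2 _]; move: mNA.
  by rewrite (f2 _ _ _ mw mw2) m2A.
have [m'A|m'NA] := boolP (m' \in class_of o.1.1.1 a); last first.
  right; exists (in_class o M' a); first exact: in_class_stab.
  move=> [m2 [mw2 m2A _]]; move: st' => /stableP[_ _ f2 _]; move: m'NA.
  by rewrite (f2 _ _ _ mw' mw2) m2A.
left; exists (in_class o M a), (in_class o M' a), m, m'.
by split=> //; exact: in_class_stab.
Qed.

Lemma multi_varying_man o m : (1 < n_stable_partners_man d o m)%N ->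
  varying_woman (class_of o.1.1.2 (o.1.1.1 m)) (class_of o.1.1.1 (o.1.1.1 m)) o.2 o.1.2 m.
Proof.
move=> /two_elements[w [w' []]]; rewrite !finset.inE.
move=> /existsP[M /andP[st /eqP mw]] /existsP[M' /andP[st' /eqP mw']] neq.
set a := o.1.1.1 m.
have mA : m \in class_of o.1.1.1 a by rewrite finset.inE.
have cs := class_stab_swap (in_class_stab a st).
have cs' := class_stab_swap (in_class_stab a st').
have [wB|wNB] := boolP (w \in class_of o.1.1.2 a); last first.
  right; exists (fun w m => in_class o M a m w); first exact: cs.
  by move=> [w2 [mw2 _ w2B]]; move: mw2 wNB; rewrite mw => -[->]; rewrite w2B.
have [w'B|w'NB] := boolP (w' \in class_of o.1.1.2 a); last first.
  right; exists (fun w m => in_class o M' a m w); first exact: cs'.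
  by move=> [w2 [mw2 _ w2B]]; move: mw2 w'NB; rewrite mw' => -[->]; rewrite w2B.
by left; exists (fun w m => in_class o M a m w), (fun w m => in_class o M' a m w), w, w'.
Qed.

Lemma card_by_class (p : {ffun 'I_n -> profile k}) (P : pred 'I_n) :
  #|[set i | P i]| = (\sum_(a : profile k) #|[set i in class_of p a | P i]|)%N.
Proof.
rewrite -sum1_card (partition_big p xpredT) //=; apply: eq_bigr => a _.
by rewrite -sum1_card; apply: eq_bigl => i; rewrite !finset.inE andbC.
Qed.

Lemma n_multi_le o : (n_multi d o <= \sum_(a : profile k)
  n_varying (class_of o.1.1.1 a) (class_of o.1.1.2 a) o.1.2 o.2)%N.
Proof.
rewrite big_split /= addnC; apply: leq_add.
  rewrite (card_by_class o.1.1.1); apply: leq_sum => a _.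
  apply/subset_leq_card/fintype.subsetP => m; rewrite !finset.inE => /andP[/eqP ma mm].
  by rewrite ma eqxx; apply/asboolP; have := multi_varying_man mm; rewrite ma.
rewrite (card_by_class o.1.1.2); apply: leq_sum => a _.
apply/subset_leq_card/fintype.subsetP => w; rewrite !finset.inE => /andP[/eqP wa mw].
by rewrite wa eqxx; apply/asboolP; have := multi_varying_woman mw; rewrite wa.
Qed.

End Global.

(** * Flipping classes of size two *)

Section Good.
Variables (n k : nat).
Local Notation lists := {ffun 'I_n -> {perm 'I_n}}.
Local Notation profs := {ffun 'I_n -> profile k}.
Implicit Types (p q : profs) (s t : lists) (a : profile k).

(* Both perfect matchings of two men and two women with these preferences are
   stable. *)
Definition cyclic s t m1 m2 w1 w2 :=
  [&& list_pref s m1 w1 w2, list_pref s m2 w2 w1,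
      list_pref t w1 m2 m1 & list_pref t w2 m1 m2].

Definition good_class p q s t a := exists m1 m2 w1 w2,
  [/\ class_of p a = [set m1; m2], class_of q a = [set w1; w2] & cyclic s t m1 m2 w1 w2].

Definition good_set (o : outcome n k) : {set profile k} :=
  [set a | `[< good_class o.1.1.1 o.1.1.2 o.1.2 o.2 a >]].

Lemma cyclic_neq s t m1 m2 w1 w2 : cyclic s t m1 m2 w1 w2 -> m1 != m2 /\ w1 != w2.
Proof.
move=> /and4P[h _ h' _]; split; apply/eqP => e.
  by move: h'; rewrite e /list_pref ltnn.
by move: h; rewrite e /list_pref ltnn.
Qed.

End Good.

Section Flip.
Variables (R : realType) (n k : nat) (d : profile k -> profile k -> R)
  (hd : is_metric d) (o : outcome n k) (M : matching_fun n) (Mst : stable d o M).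

Local Notation prof_m := o.1.1.1.
Local Notation prof_w := o.1.1.2.

(** Both sides of the class have two members, so both men are matched inside it, and injectivity
    leaves two possibilities. *)
Lemma good_matched a : a \in good_set o -> exists m1 m2 w1 w2,
  [/\ class_of prof_m a = [set m1; m2], class_of prof_w a = [set w1; w2],
      cyclic o.1.2 o.2 m1 m2 w1 w2 &
      (M m1 = Some w1 /\ M m2 = Some w2) \/ (M m1 = Some w2 /\ M m2 = Some w1)].
Proof.
rewrite finset.inE => /asboolP[m1 [m2 [w1 [w2 [EA EB cyc]]]]].
exists m1, m2, w1, w2; split=> //.
have [m12 w12] := cyclic_neq cyc.
have ic := in_class_stab hd a Mst; have le : #|class_of prof_m a| <= #|class_of prof_w a|.
  by rewrite EA EB !cards2 m12 w12.
have hw m : m \in [set m1; m2] -> M m = Some w1 \/ M m = Some w2.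
  rewrite -EA => /(class_men_matched ic le)[w [Mw _]].
  by rewrite EB !finset.inE => /orP[] /eqP<-; [left|right].
have neq : M m1 <> M m2.
  move=> E; have /stableP[_ _ f2 _] := Mst.
  have [w Mw] : exists w, M m1 = Some w.
    by case: (hw m1) => [|->|->]; [rewrite !inE eqxx|exists w1|exists w2].
  by move/eqP: m12; apply; apply: (f2 m1 m2 w) => //; rewrite -E.
have h1 : m1 \in [set m1; m2] by rewrite !inE eqxx.
have h2 : m2 \in [set m1; m2] by rewrite !inE eqxx orbT.
move: neq; case: (hw _ h1) => ->; case: (hw _ h2) => ->.
- by [].
- by left.
- by right.
- by [].
Qed.

(** The other man of a class with exactly two men; the default [m] makes the function total. *)
Definition mate (m : 'I_n) : 'I_n :=
  odflt m [pick m' | (prof_m m' == prof_m m) && (m' != m)].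

Lemma mateE a m1 m2 : class_of prof_m a = [set m1; m2] -> m1 != m2 ->
  mate m1 = m2 /\ mate m2 = m1.
Proof.
move=> EA m12.
have cl m : (prof_m m == a) = (m == m1) || (m == m2).
  by move/setP/(_ m): EA; rewrite !finset.inE.
have /eqP p1 : prof_m m1 == a by rewrite cl eqxx.
have /eqP p2 : prof_m m2 == a by rewrite cl eqxx orbT.
rewrite /mate p1 p2; split.
  case: pickP => [m|/(_ m2)]; last by rewrite p2 eqxx eq_sym m12.
  by rewrite cl => /andP[/orP[]/eqP-> //]; rewrite eqxx.
case: pickP => [m|/(_ m1)]; last by rewrite p1 eqxx m12.
by rewrite cl => /andP[/orP[]/eqP-> //]; rewrite eqxx.
Qed.

Definition flip (J : {set profile k}) : matching_fun n :=
  [ffun m => if prof_m m \in J then M (mate m) else M m].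

Variable J : {set profile k}.
Hypothesis JG : J \subset good_set o.
Local Notation mu := (fun m w => flip J m = Some w).

Lemma flip_in a : a \in J -> exists m1 m2 w1 w2,
  [/\ class_of prof_m a = [set m1; m2], class_of prof_w a = [set w1; w2],
      cyclic o.1.2 o.2 m1 m2 w1 w2 &
      (mu m1 w1 /\ mu m2 w2) \/ (mu m1 w2 /\ mu m2 w1)].
Proof.
move=> aJ; have [m1 [m2 [w1 [w2 [EA EB cyc c]]]]] := good_matched (fintype.subsetP JG _ aJ).
exists m1, m2, w1, w2; split=> //; have [m12 w12] := cyclic_neq cyc.
have [e1 e2] := mateE EA m12.
have p1 : m1 \in class_of prof_m a by rewrite EA !inE eqxx.
have p2 : m2 \in class_of prof_m a by rewrite EA !inE eqxx orbT.
move: p1 p2; rewrite !finset.inE => /eqP p1 /eqP p2.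
rewrite !ffunE p1 p2 aJ e1 e2.
by case: c => -[-> ->]; [right|left].
Qed.

Lemma flip_class m w : mu m w -> prof_m m \in J -> prof_w w = prof_m m.
Proof.
move=> muw mJ; have [m1 [m2 [w1 [w2 [EA EB cyc c]]]]] := flip_in mJ.
have : m \in class_of prof_m (prof_m m) by rewrite finset.inE.
have wE x : x \in [set w1; w2] -> prof_w x = prof_m m.
  by rewrite -EB finset.inE => /eqP.
rewrite EA !finset.inE => /orP[]/eqP mE; apply: wE; move: muw; rewrite mE;
  case: c => -[h1 h2]; rewrite ?h1 ?h2 => -[<-]; by rewrite !inE eqxx ?orbT.
Qed.

Lemma flip_woman w : prof_w w \in J -> exists2 m, mu m w & prof_m m = prof_w w.
Proof.
move=> wJ; have [m1 [m2 [w1 [w2 [EA EB cyc c]]]]] := flip_in wJ.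
have mE x : x \in [set m1; m2] -> prof_m x = prof_w w.
  by rewrite -EA finset.inE => /eqP.
have p1 : prof_m m1 = prof_w w by apply: mE; rewrite !inE eqxx.
have p2 : prof_m m2 = prof_w w by apply: mE; rewrite !inE eqxx orbT.
have : w \in class_of prof_w (prof_w w) by rewrite finset.inE.
rewrite EB !finset.inE; case: c => -[h1 h2] /orP[]/eqP wE;
  [exists m1|exists m2|exists m2|exists m1]; by rewrite // wE.
Qed.

Lemma flip_out m w : prof_m m \notin J -> mu m w -> M m = Some w.
Proof. by move=> /negPf mJ /=; rewrite ffunE mJ. Qed.

Lemma flip_inj m m' w : mu m w -> mu m' w -> m = m'.
Proof.
have /stableP[_ _ f2 _] := Mst.
have main x y : mu x w -> mu y w -> prof_m x \in J -> x = y.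
  move=> mux muy xJ; have [m1 [m2 [w1 [w2 [EA EB cyc c]]]]] := flip_in xJ.
  have [m12 /eqP w12] := cyclic_neq cyc; have [e1 e2] := mateE EA m12.
  have hx : x \in [set m1; m2] by rewrite -EA finset.inE.
  have [yJ|yNJ] := boolP (prof_m y \in J).
    have hy : y \in [set m1; m2].
      by rewrite -EA finset.inE -(flip_class muy yJ) (flip_class mux xJ).
    move: hx hy mux muy; rewrite !finset.inE => /orP[]/eqP-> /orP[]/eqP-> //;
      by case: c => -[-> ->] [<-] [e]; case: w12.
  have /(f2 _ _ _ (flip_out yNJ muy)) yE : M (mate x) = Some w.
    by move: mux; rewrite ffunE xJ.
  have : mate x \in class_of prof_m (prof_m x).
    by move: hx; rewrite EA !finset.inE => /orP[]/eqP->; rewrite ?e1 ?e2 eqxx ?orbT.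
  by rewrite -yE finset.inE => /eqP yx; move: yNJ; rewrite yx xJ.
move=> muw muw'; have [mJ|mNJ] := boolP (prof_m m \in J); first exact: main.
have [mJ'|mNJ'] := boolP (prof_m m' \in J); first by apply/esym; apply: main.
by apply: (f2 m m' w); apply: flip_out.
Qed.

(** Members of a flipped class are matched at distance zero and only prefer members of the same
    class, where cyclic preferences leave no blocking pair. The others keep their partners, so a
    blocking pair among them would block [M]. *)
Lemma flip_stable : stable d o (flip J).
Proof.
have /stableP[_ _ f2 nb] := Mst.
apply/stableP; split=> // [m w w' -> []//| |m w _ ab1 ab2]; first exact: flip_inj.
have near x y z : prof_m x = prof_w y -> man_prefers d o x z y -> prof_w z = prof_m x.
  rewrite /man_prefers /prof_man /prof_woman => <- h; apply/esym/eqP.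
  apply: contraTT h => /(dist_gt0 hd) gt0; rewrite (dist_refl hd).
  by rewrite ltNge (ltW gt0) /= gt_eqF.
have near' x y z : prof_w x = prof_m y -> woman_prefers d o x z y -> prof_m z = prof_w x.
  rewrite /woman_prefers /prof_man /prof_woman => <- h; apply/esym/eqP.
  apply: contraTT h => /(dist_gt0 hd) gt0; rewrite (dist_refl hd).
  by rewrite ltNge (ltW gt0) /= gt_eqF.
have [wJ|wNJ] := boolP (prof_w w \in J).
  have [m2 mu2 p2] := flip_woman wJ.
  have /near' := ab2 _ mu2 => /(_ (esym p2)) pm.
  have [m1 [m3 [w1 [w3 [EA EB cyc c]]]]] := flip_in wJ.
  have mE x : x \in [set m1; m3] -> prof_m x = prof_w w.
    by rewrite -EA finset.inE => /eqP.
  have wE x : x \in [set w1; w3] -> prof_w x = prof_w w.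
    by rewrite -EB finset.inE => /eqP.
  have pm1 : prof_m m1 = prof_w w by apply: mE; rewrite !inE eqxx.
  have pm3 : prof_m m3 = prof_w w by apply: mE; rewrite !inE eqxx orbT.
  have pw1 : prof_w w1 = prof_w w by apply: wE; rewrite !inE eqxx.
  have pw3 : prof_w w3 = prof_w w by apply: wE; rewrite !inE eqxx orbT.
  have mp x y z : prof_m x = prof_w w -> prof_w y = prof_w w -> prof_w z = prof_w w ->
      man_prefers d o x y z = list_pref o.1.2 x y z.
    by rewrite /man_prefers /prof_man /prof_woman => -> -> ->; rewrite ltxx eqxx.
  have wp x y z : prof_w x = prof_w w -> prof_m y = prof_w w -> prof_m z = prof_w w ->
      woman_prefers d o x y z = list_pref o.2 x y z.
    by rewrite /woman_prefers /prof_man /prof_woman => -> -> ->; rewrite ltxx eqxx.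
  have : m \in [set m1; m3] by rewrite -EA finset.inE pm.
  have : w \in [set w1; w3] by rewrite -EB finset.inE.
  have /and4P[c1 c2 c3 c4] := cyc.
  have ls s x y : list_pref s x y y -> False by rewrite /list_pref ltnn.
  have la s x y z : list_pref s x y z -> list_pref s x z y -> False.
    exact: strict_total_asym (list_pref_strict s x).
  (* Four pairs and two matchings: either the pair is itself matched, or by the cyclic preferences
     one of the two prefers the current partner. *)
  rewrite !finset.inE => /orP[]/eqP wE' /orP[]/eqP mE'; subst m w; case: c => -[h1 h3].
  all: try by move: (ab1 _ h1); rewrite mp // => /ls.
  all: try by move: (ab1 _ h3); rewrite mp // => /ls.
  all: try by move: (ab1 _ h1); rewrite mp // => /la; apply.
  all: try by move: (ab1 _ h3); rewrite mp // => /la; apply.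
  all: try by move: (ab2 _ h1); rewrite wp // => /la; apply.
  all: try by move: (ab2 _ h3); rewrite wp // => /la; apply.
have [mJ|mNJ] := boolP (prof_m m \in J).
  have [m1 [m2 [w1 [w2 [EA EB cyc c]]]]] := flip_in mJ.
  have [w' muw'] : exists w', mu m w'.
    have : m \in class_of prof_m (prof_m m) by rewrite finset.inE.
    rewrite EA !finset.inE => /orP[]/eqP->; case: c => -[h1 h2]; by [exists w1|exists w2].
  have := near _ _ _ (esym (flip_class muw' mJ)) (ab1 _ muw') => wm.
  by move: wNJ; rewrite wm mJ.
apply: (nb m w) => // [w2 Mw2|m2 Mm2].
  by apply: ab1; rewrite ffunE (negPf mNJ).
apply: ab2; rewrite ffunE; case: ifP => // m2J.
(* A man of a flipped class is matched by [M] inside this class, which would put the profile of [w]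
   into [J]. *)
have [a1 [a2 [b1 [b2 [EA EB cyc c]]]]] := good_matched (fintype.subsetP JG _ m2J).
have : m2 \in class_of prof_m (prof_m m2) by rewrite finset.inE.
have wE x : x \in [set b1; b2] -> prof_w x = prof_m m2.
  by rewrite -EB finset.inE => /eqP.

rewrite EA !finset.inE => /orP[]/eqP m2E; (suff wm : prof_w w = prof_m m2 by move: wNJ; rewrite wm m2J);
  apply: wE; move: Mm2; rewrite {1}m2E; case: c => -[h1 h2]; rewrite ?h1 ?h2 => -[<-]; by rewrite !inE eqxx ?orbT.
Qed.

End Flip.

(** * Stable matchings and stable partners obtained by flipping *)

Section GoodCount.
Variables (R : realType) (n k : nat) (d : profile k -> profile k -> R)
  (hd : is_metric d) (o : outcome n k) (M : matching_fun n) (Mst : stable d o M).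

(** Reads off from the flipped matching whether [a] belongs to [J], so that different subsets of
    [good_set o] give different flips. *)
Lemma flip_moves a J m1 m2 w1 w2 :
  class_of o.1.1.1 a = [set m1; m2] -> m1 != m2 -> w1 != w2 ->
  (M m1 = Some w1 /\ M m2 = Some w2) \/ (M m1 = Some w2 /\ M m2 = Some w1) ->
  (flip o M J m1 != M m1) = (a \in J).
Proof.
move=> EA m12 w12 c; have [e1 _] := mateE EA m12.
have : m1 \in class_of o.1.1.1 a by rewrite EA !inE eqxx.
rewrite ffunE finset.inE => /eqP->; case: ifP; rewrite ?eqxx // e1 => _.
by case: c => -[-> ->]; apply/eqP => -[e]; rewrite e eqxx in w12.
Qed.

Lemma exp_good_le : 2 ^ #|good_set o| <= n_stable_matchings d o.
Proof.
rewrite -card_powerset -(@card_in_imset _ _ (flip o M)).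
  apply/subset_leq_card/fintype.subsetP => M' /imsetP[J]; rewrite !finset.inE => JG ->.
  exact: flip_stable.
have sub J J' : J \in powerset (good_set o) -> flip o M J = flip o M J' -> J \subset J'.
  rewrite finset.inE => JG E; apply/fintype.subsetP => a aJ.
  have [m1 [m2 [w1 [w2 [EA _ cyc c]]]]] := good_matched hd Mst (fintype.subsetP JG _ aJ).
  have [m12 w12] := cyclic_neq cyc.
  by rewrite -(flip_moves J' EA m12 w12 c) -E (flip_moves J EA m12 w12 c).
by move=> J J' hJ hJ' E; apply/eqP; rewrite finset.eqEsubset !sub.
Qed.

(** In each good class the man [m1] has one of the two women in [M] and the other one after flipping
    this class alone. *)
Lemma good_le_multi : #|good_set o| <= n_multi d o.
Proof.
apply: leq_trans (leq_addr _ _).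
apply: (leq_trans _ (leq_imset_card o.1.1.1 _)).
apply/subset_leq_card/fintype.subsetP => a aG; apply/imsetP.
have [m1 [m2 [w1 [w2 [EA _ cyc c]]]]] := good_matched hd Mst aG.
have [m12 w12] := cyclic_neq cyc; have [e1 _] := mateE EA m12.
have : m1 \in class_of o.1.1.1 a by rewrite EA !inE eqxx.
rewrite finset.inE => /eqP pa; exists m1 => //; rewrite finset.inE.
have aJ : [set a] \subset good_set o by rewrite finset.sub1set.
have Fst := flip_stable hd Mst aJ.
have FE : flip o M [set a] m1 = M m2 by rewrite ffunE pa finset.inE eqxx e1.
apply/card_gt1P; exists w1, w2; rewrite !finset.inE; split=> //; apply/existsP;
  case: c => -[h1 h2]; by [exists M; rewrite Mst h1 eqxx|exists (flip o M [set a]); rewrite Fst FE h2 eqxx].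
Qed.
End GoodCount.

Lemma stable_exists (R : realType) n k (d : profile k -> profile k -> R) (o : outcome n k) :
  exists M, stable d o M.
Proof.
have st := manopt_stab (fun _ _ => True) (man_prefers_strict d o) (woman_prefers_strict d o).
move: st; set mu := manopt _ _ _ => -[_ f1 f2 nb].
pose M : matching_fun n := [ffun m => [pick w | `[< mu m w >]]].
have ME m w : M m = Some w <-> mu m w.
  rewrite ffunE; case: pickP => [w' /asboolP mw'|none]; split=> //.
  - by case=> <-.
  - by move=> mw; rewrite (f1 _ _ _ mw mw').
  - by move/asboolP; rewrite none.
exists M; apply/stableP; split=> // [m w w' -> []//|m m' w /ME mw /ME mw'|m w _ ab1 ab2].
  exact: f2 mw mw'.
by apply: (nb m w) => // [w2 /ME/ab1|m2 /ME/ab2].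
Qed.

(** * Frequency of cyclic preferences *)

Section CyclicLists.
Variable n : nat.
Local Notation lists := {ffun 'I_n -> {perm 'I_n}}.

(** Exchanging [w1] and [w2] in the list of [m] is an involution that preserves [P] and reverses
    their order. *)
Lemma half_lists (P : pred lists) m w1 w2 : w1 != w2 ->
  (forall s, P (swap_list s m w1 w2) = P s) ->
  (#|[set s | P s]| <= 2 * #|[set s | P s && list_pref s m w1 w2]|)%N.
Proof.
move=> w12 inv; pose Q := [set s : lists | list_pref s m w1 w2].
rewrite -(cardsID Q) mul2n -addnn leq_add //.
  by apply/subset_leq_card/fintype.subsetP => s; rewrite !finset.inE.
rewrite -(@card_imset _ _ (fun s => swap_list s m w1 w2)); last first.
  by apply: (can_inj (g := fun s => swap_list s m w1 w2)) => s; exact: swap_listK.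
apply/subset_leq_card/fintype.subsetP => s' /imsetP[s]; rewrite !finset.inE.
move=> /andP[nQ Ps] ->; rewrite inv Ps /list_pref ffunE eqxx !permM tpermL tpermR /=.
move: nQ; rewrite /list_pref -leqNgt leq_eqVlt => /orP[/eqP/val_inj/perm_inj e|//].
by rewrite e eqxx in w12.
Qed.

Lemma quarter_lists m1 m2 w1 w2 : m1 != m2 -> w1 != w2 ->
  (#|{: lists}| <= 4 * #|[set s : lists | list_pref s m1 w1 w2 && list_pref s m2 w2 w1]|)%N.
Proof.
move=> m12 w12; rewrite -[4%N]/(2 * 2)%N -mulnA.
have h1 := @half_lists xpredT m1 w1 w2 w12 (fun=> erefl).
rewrite -cardsT; apply: leq_trans h1 _; rewrite leq_mul2l /=.
apply: (@half_lists (fun s => list_pref s m1 w1 w2)); first by rewrite eq_sym.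
by move=> s; rewrite /list_pref ffunE (negPf m12).
Qed.

(** The conditions on [s] and [t] are independent, and each holds for at least a quarter of the
    lists. *)
Lemma sum_cyclic (R : realFieldType) m1 m2 w1 w2 : m1 != m2 -> w1 != w2 ->
  (#|{: lists}|%:R ^+ 2 <=
    16 * \sum_(s : lists) \sum_(t : lists) (cyclic s t m1 m2 w1 w2)%:R :> R)%R.
Proof.
move=> m12 w12; have h1 := quarter_lists m12 w12.
have h2 : (#|{: lists}| <= 4 * #|[set t : lists | list_pref t w1 m2 m1 && list_pref t w2 m1 m2]|)%N.
  by apply: quarter_lists; rewrite // eq_sym.
have -> : (\sum_(s : lists) \sum_(t : lists) (cyclic s t m1 m2 w1 w2)%:R =
    #|[set s : lists | list_pref s m1 w1 w2 && list_pref s m2 w2 w1]|%:R *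
    #|[set t : lists | list_pref t w1 m2 m1 && list_pref t w2 m1 m2]|%:R :> R)%R.
  rewrite -!sum1_card !natr_sum big_distrlr /= [RHS]big_mkcond.
  apply: eq_bigr => s _; rewrite finset.inE; case: ifP => Ps; last first.
    apply: big1 => t _; rewrite /cyclic andbA Ps //.
  rewrite [RHS]big_mkcond; apply: eq_bigr => t _.
  by rewrite finset.inE /cyclic andbA Ps /=; case: ifP => _; rewrite ?mul1r.
move: h1 h2; rewrite -!(ler_nat R) !natrM.
move: (#|{: lists}|%:R)%R (#|[set s | _]|%:R)%R (#|[set t | _]|%:R)%R (ler0n R #|{: lists}|).
move=> T x y T0 h1 h2.
have -> : (16 * (y * x) = (4 * y) * (4 * x))%R by ring.
by rewrite expr2 ler_pM.
Qed.

End CyclicLists.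

(** * Occupancy of a class *)

Section Occupancy.
Variables (n : nat) (V : finType) (a : V).
Local Notation maps := {ffun 'I_n -> V}.
Local Notation K := #|V|.

Definition occ (p : maps) := #|[set i | p i == a]|.

Lemma card_ffun_on_split (S : {set 'I_n}) (P Q : pred V) :
  #|[set p : maps | [forall i, p i \in if i \in S then P else Q]]|
    = (#|P| ^ #|S| * #|Q| ^ (n - #|S|))%N.
Proof.
rewrite cardsE.
rewrite -[LHS](eq_card (A := family (fun i => if i \in S then P else Q))); last first.
  by move=> p; rewrite !inE.
rewrite card_family foldrE big_image /= (bigID (mem S)) /=.
rewrite (eq_bigr (fun=> #|P|)); last by move=> i ->.
rewrite (eq_bigr (F1 := fun i => #|if i \in S then P else Q|) (fun=> #|Q|)); last first.
  by move=> i /negPf->.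
rewrite !prod_nat_const; congr (_ * _ ^ _)%N.
have := cardC (mem S); rewrite card_ord => nE.
by rewrite -[in X in _ = (X - _)%N]nE addKn; apply: eq_card.
Qed.

Lemma card_occ x : #|[set p : maps | occ p == x]| = ('C(n, x) * K.-1 ^ (n - x))%N.
Proof.
rewrite -sum1_card.
rewrite (partition_big (fun p : maps => [set i | p i == a]) (fun S : {set 'I_n} => #|S| == x)) /=; last first.
  by move=> p; rewrite finset.inE.
rewrite (eq_bigr (fun=> (K.-1 ^ (n - x))%N)); last first.
  move=> S /eqP Sx; rewrite -[RHS]mul1n -Sx -[in RHS](exp1n #|S|).
  rewrite -[in X in (X ^ _ * _)%N](card1 a) -(cardC1 a) -card_ffun_on_split -sum1_card.
  apply: eq_bigl => p; rewrite !finset.inE; apply/andP/forallP.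
    move=> [_ /eqP pS] i; rewrite -pS finset.inE; case: eqP => pi; rewrite inE //=.
      by apply/eqP.
    by apply/eqP.
  move=> h; suff pS : [set i | p i == a] = S by rewrite /occ pS Sx.
  apply/setP => i; rewrite finset.inE; have := h i.
  by case: ifP; rewrite !inE // => _ /negPf.
rewrite sum_nat_const; congr (_ * _)%N.
by rewrite -[in RHS](card_ord n) -card_draws; apply: eq_card => S; rewrite !inE.
Qed.

(** For [S] of one and two elements this yields the first two factorial moments of [occ]. *)
Lemma card_pinned (S : {set 'I_n}) :
  (#|[set p : maps | [forall i in S, p i == a]]| * K ^ #|S| = K ^ n)%N.
Proof.
have := card_ffun_on_split S (pred1 a) predT.
rewrite card1 exp1n mul1n; set X := [set p | _] => E.
have -> : [set p : maps | [forall i in S, p i == a]] = X.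
  apply/setP => p; rewrite !finset.inE; apply: eq_forallb => i.
  by case: (i \in S); rewrite !inE.
rewrite E -expnD subnK //.
by have := max_card S; rewrite card_ord.
Qed.

Lemma occE p : occ p = (\sum_i (p i == a))%N.
Proof. by rewrite /occ -sum1_card big_mkcond; apply: eq_bigr => i _; rewrite finset.inE; case: eqP. Qed.

Lemma sum_occ : ((\sum_p occ p) * K = n * K ^ n)%N.
Proof.
under eq_bigr do rewrite occE.
rewrite exchange_big big_distrl /= -[X in (X * _)%N](card_ord n) -sum_nat_const.
apply: eq_bigr => i _; rewrite -(card_pinned [set i]) cards1 expn1; congr (_ * _)%N.
rewrite -sum1_card [RHS]big_mkcond; apply: eq_bigr => p _; rewrite finset.inE.
have -> : [forall j in [set i], p j == a] = (p i == a).
  by apply/'forall_implyP/idP => [/(_ i)|pi j]; rewrite !inE ?eqxx //; [apply|move=> /eqP->].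
by case: eqP.
Qed.

Lemma sum_occ_pairs : ((\sum_p occ p * (occ p).-1) * K ^ 2 = n * n.-1 * K ^ n)%N.
Proof.
have E p : (occ p * (occ p).-1 = \sum_i \sum_(j | j != i) (p i == a) && (p j == a))%N.
  transitivity (\sum_(i in [set i | p i == a]) (occ p).-1)%N.
    by rewrite sum_nat_const.
  rewrite big_mkcond; apply: eq_bigr => i _; rewrite finset.inE; case: ifP => pi /=.
    by rewrite occE (bigD1 i) //= pi.
  by rewrite big1.
under eq_bigr do rewrite E.
rewrite exchange_big big_distrl /= -mulnA -[X in _ = (X * _)%N](card_ord n) -sum_nat_const.
apply: eq_bigr => i _; rewrite exchange_big big_distrl /=.
have -> : n.-1 = #|[pred j : 'I_n | j != i]|.
  by have := cardC1 i; rewrite card_ord => <-; apply: eq_card.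
rewrite -sum_nat_const; apply: eq_bigr => j ji.
rewrite -(card_pinned [set i; j]) cards2 eq_sym ji; congr (_ * _)%N.
rewrite -sum1_card [RHS]big_mkcond; apply: eq_bigr => p _; rewrite finset.inE.
have -> : [forall l in [set i; j], p l == a] = (p i == a) && (p j == a).
  apply/'forall_implyP/andP => [h|[pi pj] l].
    by split; apply: h; rewrite !inE eqxx ?orbT.
  by rewrite !inE => /orP[]/eqP->.
by case: (_ && _).
Qed.

End Occupancy.

Local Open Scope ring_scope.

(** Bernoulli's inequality [(1 - t) ^ j >= 1 - j * t], along a sequence. *)
Lemma slowly_decreasing (R : realFieldType) (u : nat -> R) (t : R) (L : nat) :
  0 <= t <= 1 -> (forall i, 0 <= u i) ->
  (forall i, (i < L)%N -> (1 - t) * u i <= u i.+1) ->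
  forall j, (j <= L)%N -> (1 - j%:R * t) * u 0%N <= u j.
Proof.
move=> /andP[t0 t1] u0 step; elim=> [|j IH] jL; first by rewrite mul0r subr0 mul1r.
apply: le_trans (step j jL); have := IH (ltnW jL) => {}IH.
have : (1 - t) * ((1 - j%:R * t) * u 0%N) <= (1 - t) * u j.
  by rewrite ler_wpM2l // subr_ge0.
apply: le_trans; rewrite mulrA ler_wpM2r // -natr1.
have : 0 <= j%:R * (t * t) by rewrite !mulr_ge0.
by move: (j%:R) => x; nra.
Qed.

(** * Anticoncentration of the binomial distribution *)

Section Anticoncentration.
Variables (R : realFieldType) (n : nat) (V : finType) (a : V).
Local Notation maps := {ffun 'I_n -> V}.
Local Notation K := (#|V|%:R : R).
Local Notation s := (n%:R / K).
Definition occ_count (x : nat) : nat := #|[set p : maps | occ a p == x]|.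

Lemma occ_ratio y : (1 < #|V|)%N ->
  y.+1%:R * (K - 1) * (occ_count y.+1)%:R = (n%:R - y%:R) * (occ_count y)%:R :> R.
Proof.
move=> K1; have -> : K - 1 = #|V|.-1%:R by rewrite -subn1 natrB // ltnW.
rewrite /occ_count !card_occ; case: (leqP n y) => ny.
  rewrite bin_small // mul0n mulr0.
  move: ny; rewrite leq_eqVlt => /orP[/eqP->|ny]; first by rewrite subrr mul0r.
  by rewrite bin_small // mul0n mulr0.
rewrite -natrB ?(ltnW ny) // -!natrM; congr (_%:R).
rewrite [RHS]mulnA -mul_bin_left -(subnSK ny) expnS.
by rewrite -!mulnA; congr (_ * _)%N; rewrite mulnCA.
Qed.

Lemma occ_count_sum_le m (f : 'I_m -> nat) : injective f ->
  \sum_(j < m) (occ_count (f j))%:R <= (#|V| ^ n)%:R :> R.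
Proof.
move=> f_inj; rewrite -natr_sum ler_nat.
rewrite -[X in (_ <= _ ^ X)%N](card_ord n) -card_ffun -sum1_card.
under eq_bigr do rewrite /occ_count -sum1_card big_mkcond /=.
rewrite exchange_big /=; apply: leq_sum => p _.
case: (pickP (fun j => occ a p == f j)) => [j pj|none]; last first.
  by rewrite big1 // => j _; rewrite finset.inE none.
rewrite (bigD1 j) //= finset.inE pj big1 // => i ij; rewrite finset.inE.
by rewrite (eqP pj) (inj_eq f_inj) eq_sym (negPf ij).
Qed.

(* From [x] towards the mean [s], the next [L] values of [occ_count] are at least
   half of [occ_count x]. *)
Lemma anticoncentration (L x : nat) : (0 < L)%N -> (1 < #|V|)%N ->
  (4 * L ^ 2 * #|V| <= n)%N ->
  (occ_count x)%:R <= 2 / L.+1%:R * (#|V| ^ n)%:R :> R.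
Proof.
move=> L0 K1 hn.
have Kgt : 1 <= K - 1 by rewrite lerBrDr -(natrD _ 1 1) ler_nat.
have K0 : 0 < K by lra.
have L1 : 1 <= L%:R :> R by rewrite ler1n.
have sK : n%:R = s * K by rewrite divfK // gt_eqF.
have s4 : 4 * L%:R * L%:R <= s.
  by rewrite ler_pdivlMr // -!natrM ler_nat; move: hn; rewrite expnS expn1 mulnA.
have s0 : 0 < s by nra.
(* Along the way, consecutive counts have ratio at least [(s - L) / (s + L) >= 1 - t]; [L] steps
   lose at most [L * t <= 1 / 2] since [s >= 4 * L ^ 2]. *)
set t := 2 * L%:R / s.
have ts : t * s = 2 * L%:R by rewrite divfK // gt_eqF.
have t0 : 0 <= t by apply: divr_ge0; [lra|exact: ltW].
have tL : t * L%:R <= 1 / 2.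
  by rewrite /t mulrAC ler_pdivrMr //; lra.
have t1 : t <= 1 by nra.
have c0 y : 0 <= (occ_count y)%:R :> R by [].
have flatten u v : 0 <= u -> 0 <= v -> (s - L%:R) * (K - 1) * u <= (s + L%:R) * (K - 1) * v -> (1 - t) * u <= v.
  move=> u0 v0 h.
  have {}h : (s - L%:R) * u <= (s + L%:R) * v.
    rewrite -(@ler_pM2r _ (K - 1)); last by lra.
    by rewrite mulrAC [X in _ <= X]mulrAC.
  have sL : 0 < s + L%:R by lra.
  rewrite -(ler_pM2l sL); apply: le_trans h; rewrite mulrA ler_wpM2r //.
  have : 0 <= t * L%:R by nra.
  by rewrite mulrDl mulrBr; move: ts; rewrite mulrC; lra.
suff [f [f_inj fP]] : exists f : nat -> nat,
    (forall i j, (i <= L)%N -> (j <= L)%N -> f i = f j -> i = j) /\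
    forall j, (j <= L)%N -> (1 - j%:R * t) * (occ_count x)%:R <= (occ_count (f j))%:R :> R.
  have := @occ_count_sum_le L.+1 (fun j => f j) (fun i j e =>
    val_inj (f_inj i j (leq_ord i) (leq_ord j) e)).
  have : \sum_(j < L.+1) (1 / 2 * (occ_count x)%:R) <=
      \sum_(j < L.+1) (occ_count (f j))%:R :> R.
    apply: ler_sum => j _; have jL := leq_ord j; apply: le_trans (fP j jL).
    rewrite ler_wpM2r // lerBrDr; have : j%:R * t <= L%:R * t by rewrite ler_wpM2r // ler_nat.
    by lra.
  rewrite sumr_const card_ord -mulr_natl => h1 h2.
  rewrite mulrAC ler_pdivlMr ?ltr0n // mulrC.
  by have := le_trans h1 h2; lra.
have [xs|xs] := leP x%:R s.
  exists (fun j => x + j)%N; split=> [i j _ _ /addnI//|].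
  have -> : occ_count x = occ_count (x + 0) by rewrite addn0.
  apply: (@slowly_decreasing _ (fun j => (occ_count (x + j))%:R)); rewrite ?t0 //.
  move=> i iL; apply: flatten => //; rewrite addnS.
  have iL' : i%:R + 1 <= L%:R :> R by rewrite natr1 ler_nat.
  apply: (@le_trans _ _ ((n%:R - (x + i)%:R) * (occ_count (x + i))%:R)).
    by apply: ler_wpM2r => //; rewrite natrD; nra.
  rewrite -occ_ratio //; apply: ler_wpM2r => //; apply: ler_wpM2r; first lra.
  by rewrite -natr1 natrD; lra.
(* Here [x > s >= L], so [L] steps down stay clear of truncation at zero. *)
have Lx : (L <= x)%N by rewrite -(ler_nat R); nra.
exists (fun j => x - j)%N; split=> [i j iL jL|].
  by move=> e; rewrite -(subKn (leq_trans iL Lx)) e subKn // (leq_trans jL Lx).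
have -> : occ_count x = occ_count (x - 0) by rewrite subn0.
apply: (@slowly_decreasing _ (fun j => (occ_count (x - j))%:R)); rewrite ?t0 //.
move=> i iL; apply: flatten => //.
have ix : (i < x)%N by apply: leq_trans Lx.
have iL' : i%:R + 1 <= L%:R :> R by rewrite natr1 ler_nat.
have yE : (x - i.+1)%:R = x%:R - i%:R - 1 :> R by rewrite natrB // -natr1 opprD addrA.
rewrite -(subnSK ix).
apply: (@le_trans _ _ ((x - i.+1).+1%:R * (K - 1) * (occ_count (x - i.+1).+1)%:R)).
  apply: ler_wpM2r => //; apply: ler_wpM2r; first lra.
  by rewrite -natr1 yE; lra.
rewrite occ_ratio //; apply: ler_wpM2r => //; rewrite yE.
have : s + L%:R <= (s + L%:R) * (K - 1) by nra.
by nra.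
Qed.

End Anticoncentration.

(** * Difference between the two sides of a class *)

Section ClassEstimate.
Variables (R : realType) (n : nat) (V : finType) (a : V).
Local Notation maps := {ffun 'I_n -> V}.
Local Notation K := (#|V|%:R : R).
Local Notation N := ((#|V| ^ n)%:R : R).
Local Notation s := (n%:R / K).
Local Notation X p := ((occ a p)%:R : R).
Local Notation D p q := ((gap (occ a p) (occ a q))%:R : R).

Lemma K_gt0 : 0 < K.
Proof. by rewrite ltr0n; apply/card_gt0P; exists a. Qed.

Lemma card_maps : #|{: maps}| = (#|V| ^ n)%N.
Proof. by rewrite card_ffun card_ord. Qed.

Lemma sum_X : \sum_(p : maps) X p = s * N.
Proof.
have K0 := K_gt0; have := congr1 (fun x => x%:R : R) (@sum_occ n V a).
rewrite !natrM natr_sum => E; apply: (mulIf (lt0r_neq0 K0)).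
by rewrite E mulrAC divfK ?lt0r_neq0.
Qed.

Lemma sum_X2 : \sum_(p : maps) X p ^+ 2 <= (s ^+ 2 + s) * N.
Proof.
have K0 := K_gt0; have := congr1 (fun x => x%:R : R) (@sum_occ_pairs n V a).
rewrite !natrM natr_sum => E.
have -> : \sum_(p : maps) X p ^+ 2 =
    \sum_(p : maps) (occ a p * (occ a p).-1)%:R + \sum_(p : maps) X p.
  rewrite -big_split; apply: eq_bigr => p _ /=; rewrite -natrD -natrX.
  by congr (_%:R); case: (occ a p) => // x; rewrite expnS expn1 -mulnSr.
rewrite sum_X mulrDl lerD2r -(ler_pM2r (mulr_gt0 K0 K0)) E.
have -> : s ^+ 2 * N * (K * K) = n%:R * n%:R * N by field; rewrite lt0r_neq0.
by rewrite ler_wpM2r // ler_wpM2l // ler_nat leq_pred.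
Qed.

Lemma gap_sqr x y : (gap x y)%:R ^+ 2 = (x%:R - y%:R) ^+ 2 :> R.
Proof.
rewrite /gap; case: (leqP x y) => [xy|/ltnW xy].
  by rewrite (eqP xy) add0n natrB // -sqrrN opprB.
by rewrite (eqP xy) addn0 natrB.
Qed.

(** For two independent copies the mean squared difference is twice the variance, which is at most
    [s]. *)
Lemma sum_gap2 : \sum_(p : maps) \sum_(q : maps) D p q ^+ 2 <= 2 * s * N ^+ 2.
Proof.
have E (p q : maps) : D p q ^+ 2 = X p ^+ 2 + X q ^+ 2 - 2 * X p * X q.
  by rewrite gap_sqr; ring.
under eq_bigr do under eq_bigr do rewrite E.
have -> : \sum_(p : maps) \sum_(q : maps) (X p ^+ 2 + X q ^+ 2 - 2 * X p * X q) =
    2 * N * (\sum_(p : maps) X p ^+ 2) - 2 * (\sum_(p : maps) X p) ^+ 2.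
  under eq_bigr => p _ do rewrite sumrB big_split /= sumr_const -big_distrr /=.
  rewrite sumrB big_split /= sumr_const -big_distrl -big_distrr /= card_maps.
  rewrite sumrMnl; move: (#|V| ^ n)%N (\sum_i X i ^+ 2) (\sum_i X i) => M S2 S1.
  by rewrite -(mulr_natl S2 M); ring.
rewrite sum_X; have N0 : 0 <= N by [].
by move/(ler_wpM2l N0): sum_X2; move: N N0 s (\sum_p _) => M M0 t S2; nra.
Qed.

(** Either [D <= th * s], or [D <= D ^ 2 / (th * s)], and the latter has mean at most [2 / th]. *)
Lemma sum_gap (th : R) : 0 < th -> 0 < s -> 
  \sum_(p : maps) \sum_(q : maps) D p q <= (th * s + 2 / th) * N ^+ 2.
Proof.
move=> th0 s0; have ts : 0 < th * s by rewrite mulr_gt0.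
apply: (@le_trans _ _ (\sum_(p : maps) \sum_(q : maps) (th * s + D p q ^+ 2 / (th * s)))).
  apply: ler_sum => p _; apply: ler_sum => q _; have D0 : 0 <= D p q by [].
  have [h|h] := leP (D p q) (th * s).
    by rewrite (le_trans h) // lerDl divr_ge0 ?sqr_ge0 ?ltW.
  apply: (@le_trans _ _ (D p q ^+ 2 / (th * s))); last by rewrite lerDr ltW.
  by rewrite ler_pdivlMr // expr2 ler_wpM2l // ltW.
under eq_bigr do rewrite big_split /= sumr_const -big_distrl /=.
rewrite big_split /= sumr_const -big_distrl /= card_maps mulrDl.
rewrite lerD //.
  by move: (#|V| ^ n)%N (th * s) => M c; rewrite -(mulr_natr c M) -mulrnAr -(mulr_natr _ M) expr2.
rewrite ler_pdivrMr //; apply: le_trans sum_gap2 _.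
by move: N s ts => M t ts; rewrite le_eqVlt; apply/orP; left; apply/eqP; field; rewrite !lt0r_neq0.
Qed.

(** Unless the count of [q] is within [L] of [x], the term is at most [1 / L]. The remaining [2 * L]
    values have probability at most [2 / L ^ 2] each, by anticoncentration with [L ^ 2] in place of
    [L]. *)
Lemma sum_inv_gap (x L : nat) : (0 < L)%N -> (1 < #|V|)%N ->
  (4 * (L ^ 2) ^ 2 * #|V| <= n)%N ->
  \sum_(q : maps) ((gap x (occ a q)).+1%:R : R)^-1 <= 5 / L%:R * N.
Proof.
move=> L0 K1 hn; have L0' : 0 < L%:R :> R by rewrite ltr0n.
pose near (q : maps) := [exists j : 'I_(2 * L), occ a q + L == x + j]%N.
apply: (@le_trans _ _ (\sum_(q : maps) (L%:R^-1 + (near q)%:R))).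
  apply: ler_sum => q _; case: (boolP (near q)) => [_|/existsPn far].
    rewrite -[Z in Z <= _]add0r lerD ?invr_ge0 // invf_le1 ?ltr0n // ler1n //.
  rewrite addr0 lef_pV2 ?posrE ?ltr0n // ler_nat leqNgt; apply/negP => lt.
  have jL : (occ a q + L - x < 2 * L)%N by move: lt; rewrite /gap; lia.
  have := far (Ordinal jL); rewrite /= => /eqP; apply.
  by move: lt; rewrite /gap; lia.
rewrite big_split /= sumr_const card_maps -(mulr_natr _ (#|V| ^ n)).
have -> : 5 / L%:R * N = L%:R^-1 * N + 4 / L%:R * N by field; rewrite lt0r_neq0.
rewrite lerD2l.
apply: (@le_trans _ _ (\sum_(q : maps) \sum_(j < 2 * L) ((occ a q + L == x + j)%N)%:R)).
  apply: ler_sum => q _; case: (boolP (near q)) => [/existsP[j jP]|_]; last exact: sumr_ge0.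
  by rewrite (bigD1 j) //= jP lerDl sumr_ge0.
rewrite exchange_big /=.
apply: (@le_trans _ _ (\sum_(j < 2 * L) (2 / (L ^ 2)%:R * N))).
  apply: ler_sum => j _; have L2 : (0 < L ^ 2)%N by rewrite expn_gt0 L0.
  rewrite -natr_sum.
  have le : (\sum_(q : maps) (occ a q + L == x + j)%N <= occ_count n a (x + j - L))%N.
    rewrite /occ_count -sum1_card [Z in (_ <= Z)%N]big_mkcond; apply: leq_sum => q _.
    by rewrite finset.inE; case: eqP => // E; rewrite ifT //; apply/eqP; lia.
  apply: (@le_trans _ _ (occ_count n a (x + j - L))%:R); first by rewrite ler_nat.
  apply: le_trans (anticoncentration R a _ L2 K1 hn) _.
  rewrite ler_wpM2r // ler_wpM2l // lef_pV2 ?posrE ?ltr0n // ler_nat //.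
rewrite sumr_const card_ord -[Z in Z <= _]mulr_natl !natrM.
rewrite le_eqVlt; apply/orP; left; apply/eqP; field.
by rewrite lt0r_neq0.
Qed.

End ClassEstimate.

(** * Expected number of participants with several stable partners *)

Lemma sum_outcome (R : nmodType) n k (F : {ffun 'I_n -> profile k} -> {ffun 'I_n -> profile k} ->
    {ffun 'I_n -> {perm 'I_n}} -> {ffun 'I_n -> {perm 'I_n}} -> R) :
  \sum_(o : outcome n k) F o.1.1.1 o.1.1.2 o.1.2 o.2 =
  \sum_p \sum_q \sum_s \sum_t F p q s t.
Proof.
by rewrite !pair_bigA /=; apply: eq_bigr => -[[[p q] s] t].
Qed.

Lemma card_profile k : #|{: profile k}| = (2 ^ k)%N.
Proof. by rewrite card_ffun card_bool card_ord. Qed.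

Lemma card_outcome n k : #|{: outcome n k}| =
  (((2 ^ k) ^ n) ^ 2 * #|{: {ffun 'I_n -> {perm 'I_n}}}| ^ 2)%N.
Proof. by rewrite !card_prod card_ffun card_profile card_ord -!mulnn !mulnA. Qed.

Lemma gapC x y : gap x y = gap y x.
Proof. exact: addnC. Qed.

(** The summand is the bound of [sum_n_varying] divided by the gap plus one, with [occ] as class
    size. *)
Lemma sum_class_estimate (R : realType) (th : R) : 0 < th ->
  exists S : nat, forall n (V : finType) (a : V), (1 < #|V|)%N -> (S * #|V| <= n)%N ->
    \sum_(p : {ffun 'I_n -> V}) \sum_(q : {ffun 'I_n -> V})
      (4 * ((occ a p)%:R + (occ a q)%:R) * ((gap (occ a p) (occ a q)).+1%:R)^-1 +
         (gap (occ a p) (occ a q))%:R)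
    <= th * (n%:R / #|V|%:R) * ((#|V| ^ n)%:R ^+ 2) :> R.
Proof.
(* [L] makes each of the two terms [4 * 5 / L] at most [th / 6]. With [th / 3] in [sum_gap], the
   condition [s >= 18 / th ^ 2] makes [6 / th] at most [th / 3 * s]; the total is [th * s]. *)
move=> th0; set L := (Num.truncn (120 / th)).+1; set S0 := (Num.truncn (18 / th ^+ 2)).+1.
exists (4 * (L ^ 2) ^ 2 + S0)%N => n V a V1 hn.
have K0 := K_gt0 R a; set s := n%:R / _.
have sS : S0%:R <= s.
  rewrite ler_pdivlMr // -natrM ler_nat; apply: leq_trans hn.
  by rewrite leq_mul2r leq_addl orbT.
have hn' : (4 * (L ^ 2) ^ 2 * #|V| <= n)%N.
  by apply: leq_trans hn; rewrite leq_mul2r leq_addr orbT.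
have Lth : 120 / th <= L%:R by apply/ltW/truncnS_gt.
have sth : 18 / th ^+ 2 <= s by apply: le_trans sS; apply/ltW/truncnS_gt.
have L0 : 0 < L%:R :> R by rewrite ltr0n.
have s0 : 0 < s by apply: lt_le_trans sth; rewrite divr_gt0 // exprn_gt0.
set M := (#|V| ^ n)%N.
have one : \sum_(p : {ffun 'I_n -> V}) \sum_(q : {ffun 'I_n -> V})
    ((occ a p)%:R * ((gap (occ a p) (occ a q)).+1%:R)^-1)
    <= 5 / L%:R * s * M%:R ^+ 2 :> R.
  apply: (@le_trans _ _ (\sum_(p : {ffun 'I_n -> V}) (occ a p)%:R * (5 / L%:R * M%:R))).
    apply: ler_sum => p _; rewrite -big_distrr /= ler_wpM2l //.
    exact: sum_inv_gap.
  by rewrite -big_distrl /= sum_X -/s -/M expr2 le_eqVlt; apply/orP; left; apply/eqP; ring.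
have two : \sum_(p : {ffun 'I_n -> V}) \sum_(q : {ffun 'I_n -> V})
    ((occ a q)%:R * ((gap (occ a p) (occ a q)).+1%:R)^-1)
    <= 5 / L%:R * s * M%:R ^+ 2 :> R.
  rewrite exchange_big; apply: le_trans one; apply: ler_sum => p _.
  by apply: ler_sum => q _; rewrite gapC.
have gp := @sum_gap R n V a (th / 3) (divr_gt0 th0 (ltr0n R 3)) s0.
have -> : \sum_(p : {ffun 'I_n -> V}) \sum_(q : {ffun 'I_n -> V})
      (4 * ((occ a p)%:R + (occ a q)%:R) * ((gap (occ a p) (occ a q)).+1%:R)^-1 +
         (gap (occ a p) (occ a q))%:R) =
   4 * (\sum_(p : {ffun 'I_n -> V}) \sum_(q : {ffun 'I_n -> V})
    ((occ a p)%:R * ((gap (occ a p) (occ a q)).+1%:R)^-1)) +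
   4 * (\sum_(p : {ffun 'I_n -> V}) \sum_(q : {ffun 'I_n -> V})
    ((occ a q)%:R * ((gap (occ a p) (occ a q)).+1%:R)^-1)) +
   \sum_(p : {ffun 'I_n -> V}) \sum_(q : {ffun 'I_n -> V}) (gap (occ a p) (occ a q))%:R :> R.
  rewrite !big_distrr -!big_split; apply: eq_bigr => p _ /=.
  rewrite !big_distrr -!big_split; apply: eq_bigr => q _ /=; ring.
move: one two gp; rewrite -/s -/M.
move: (\sum_p _) (\sum_p _) (\sum_p _) => A B C one two gp.
have M0 : 0 <= M%:R ^+ 2 :> R by rewrite exprn_ge0.
have h1 : 5 / L%:R * s <= th / 24 * s.
  apply: ler_wpM2r; first exact: ltW.
  rewrite ler_pdivrMr //.
  by move: Lth; rewrite ler_pdivrMr //; lra.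
have h2 : 2 / (th / 3) <= th / 3 * s.
  move: sth; rewrite ler_pdivrMr ?exprn_gt0 // => sth.
  by rewrite ler_pdivrMr; nra.
have h1' := ler_wpM2r M0 h1; have h2' := ler_wpM2r M0 h2.
move: one two gp h1' h2'; rewrite mulrDl -!(mulrA _ s) => one two gp h1' h2'; lra.
Qed.

(** Each of the [2 ^ k] classes contributes at most [th * n / 2 ^ k] on average. *)
Lemma sum_n_multi_le (R : realType) (th : R) : 0 < th -> exists S : nat,
  forall n k (d : profile k -> profile k -> R), is_metric d -> (0 < k)%N ->
    (S * 2 ^ k <= n)%N ->
    \sum_(o : outcome n k) (n_multi d o)%:R <= th * n%:R * #|{: outcome n k}|%:R.
Proof.
move=> /sum_class_estimate[S hS]; exists S => n k d hd k0 hn.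
set T := #|{: {ffun 'I_n -> {perm 'I_n}}}|.
have V1 : (1 < #|{: profile k}|)%N by rewrite card_profile -{1}(expn0 2) ltn_exp2l.
have cls a : \sum_(o : outcome n k)
    (n_varying (class_of o.1.1.1 a) (class_of o.1.1.2 a) o.1.2 o.2)%:R <=
    th * (n%:R / (2 ^ k)%:R) * (((2 ^ k) ^ n)%:R ^+ 2) * T%:R ^+ 2 :> R.
  rewrite (@sum_outcome R n k (fun p q s t =>
    (n_varying (class_of p a) (class_of q a) s t)%:R)).
  have := hS n (profile k) a V1; rewrite card_profile => /(_ hn).
  move=> /(ler_wpM2r (exprn_ge0 2 (ler0n R T))); apply: le_trans.
  rewrite big_distrl /=; apply: ler_sum => p _.
  rewrite big_distrl /=; apply: ler_sum => q _.
  under eq_bigr do rewrite -natr_sum.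
  rewrite -natr_sum; have := sum_n_varying (class_of p a) (class_of q a).
  rewrite -[#|class_of p a|]/(occ a p) -[#|class_of q a|]/(occ a q) -/T.
  move: (gap _ _) => D; move: (occ a p) (occ a q) => x y; rewrite -(ler_nat R).
  rewrite !(natrM, natrD, natrX) mulrC -ler_pdivlMr ?ltr0n //.
  move=> h; apply: le_trans h _; rewrite le_eqVlt; apply/orP; left; apply/eqP.
  by field; rewrite addrC natr1 pnatr_eq0.
apply: (@le_trans _ _ (\sum_(a : profile k) \sum_(o : outcome n k)
    (n_varying (class_of o.1.1.1 a) (class_of o.1.1.2 a) o.1.2 o.2)%:R)).
  rewrite exchange_big; apply: ler_sum => o _.
  by rewrite -natr_sum ler_nat n_multi_le.
apply: le_trans (ler_sum _ (fun a _ => cls a)) _.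
rewrite sumr_const card_profile card_outcome -/T natrM !(natrX R _ 2).
have : (2 ^ k)%:R != 0 :> R by rewrite pnatr_eq0 expn_eq0.
clear cls; move: ((2 ^ k) ^ n)%N (2 ^ k)%N T => M K T K0; rewrite -(mulr_natr _ K).
by rewrite le_eqVlt; apply/orP; left; apply/eqP; field.
Qed.

(** * Efron-Stein inequality *)

Section EfronStein.
Variable R : realFieldType.

(* [#|A| ^ 2] times the variance of [f] under the uniform law on [A]. *)
Definition variance (A : finType) (f : A -> R) : R :=
  #|A|%:R * (\sum_x f x ^+ 2) - (\sum_x f x) ^+ 2.

(** The law of total variance, with denominators cleared. *)
Lemma variance_pair (A B : finType) (f : A * B -> R) :
  variance f = #|A|%:R * (\sum_a variance (fun b => f (a, b)))
    + variance (fun a => \sum_b f (a, b)).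
Proof.
rewrite /variance card_prod natrM sumrB -big_distrr /=.
rewrite (pair_bigA _ (fun a b => f (a, b))) (pair_bigA _ (fun a b => f (a, b) ^+ 2)) /=.
have -> : \sum_p f (p.1, p.2) = \sum_p f p by apply: eq_bigr => -[].
have -> : \sum_p f (p.1, p.2) ^+ 2 = \sum_p f p ^+ 2 by apply: eq_bigr => -[].
by rewrite mulrBr mulrA addrA subrK.
Qed.

(** Twice the variance is the mean of [(f x - f y) ^ 2] over independent [x] and [y]. *)
Lemma variance_diff (A : finType) (f : A -> R) (c : R) :
  (forall x y, `|f x - f y| <= c) -> variance f <= c ^+ 2 * #|A|%:R ^+ 2.
Proof.
move=> fc; have E : 2 * variance f = \sum_x \sum_y (f x - f y) ^+ 2.
  transitivity (\sum_x \sum_y (f x ^+ 2 + f y ^+ 2 - 2 * f x * f y)); last first.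
    by apply: eq_bigr => x _; apply: eq_bigr => y _; ring.
  under eq_bigr => x _ do rewrite sumrB big_split /= sumr_const -big_distrr /=.
  rewrite sumrB big_split /= sumr_const -big_distrl -big_distrr /= sumrMnl /variance.
  move: (#|A|) (\sum_x f x ^+ 2) (\sum_x f x) => M S2 S1.
  by rewrite -(mulr_natl S2 M); ring.
rewrite -(ler_pM2l (ltr0n R 2)) E.
apply: (@le_trans _ _ (\sum_(x : A) \sum_(y : A) c ^+ 2)).
  apply: ler_sum => x _; apply: ler_sum => y _.
  by rewrite -real_normK ?num_real // lerXn2r ?nnegrE ?(le_trans _ (fc x y)).
rewrite !sumr_const; move: #|A| => M.
rewrite -(mulr_natr (c ^+ 2) M) -(mulr_natr (_ * _) M) -mulrA -expr2.
by have := mulr_ge0 (sqr_ge0 c) (sqr_ge0 (M%:R : R)); lra.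
Qed.

Definition bounded_diff (n : nat) (T : finType) (f : {ffun 'I_n -> T} -> R) (c : R) :=
  forall (x y : {ffun 'I_n -> T}) i, (forall j, j != i -> x j = y j) -> `|f x - f y| <= c.

Lemma variance_reindex (A B : finType) (h : B -> A) (f : A -> R) :
  bijective h -> variance f = variance (f \o h).
Proof.
move=> hb; rewrite /variance (bij_eq_card hb).
by rewrite (reindex h) ?(reindex h (P := xpredT) (F := f)) //=; apply: onW_bij.
Qed.

Definition ffun_cons n (T : finType) (p : T * {ffun 'I_n -> T}) : {ffun 'I_n.+1 -> T} :=
  [ffun i => if unlift ord0 i is Some j then p.2 j else p.1].

Lemma ffun_cons_bij n (T : finType) : bijective (@ffun_cons n T).
Proof.
exists (fun x : {ffun 'I_n.+1 -> T} => (x ord0, [ffun j : 'I_n => x (lift ord0 j)])) => [[t q]|x].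
  by congr (_, _); rewrite ?ffunE ?unlift_none //; apply/ffunP => j; rewrite !ffunE liftK.
by apply/ffunP => i; rewrite ffunE; case: unliftP => [j|] -> //=; rewrite ffunE.
Qed.

(** Induction on [n], splitting off the first coordinate: with it fixed the induction hypothesis
    applies, and the sum over the others changes by at most [c] per term. *)
Lemma variance_ffun n (T : finType) (f : {ffun 'I_n -> T} -> R) (c : R) :
  bounded_diff f c -> variance f <= n%:R * c ^+ 2 * #|{: {ffun 'I_n -> T}}|%:R ^+ 2.
Proof.
elim: n => [|n IH] in f c *.
  move=> _; rewrite !mul0r; have -> : 0 = 0 ^+ 2 * #|{: {ffun 'I_0 -> T}}|%:R ^+ 2 :> R.
    by rewrite expr0n /= mul0r.
  apply: variance_diff => x y; rewrite (_ : x = y) ?subrr ?normr0 //.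
  by apply/ffunP => -[].
move=> bd; rewrite (variance_reindex f (ffun_cons_bij n T)) variance_pair.
have -> : #|{: {ffun 'I_n.+1 -> T}}|%:R = #|T|%:R * #|{: {ffun 'I_n -> T}}|%:R :> R.
  by rewrite -natrM !card_ffun !card_ord expnS.
have h1 : \sum_a variance (fun b => (f \o @ffun_cons n T) (a, b)) <=
    \sum_(a : T) (n%:R * c ^+ 2 * #|{: {ffun 'I_n -> T}}|%:R ^+ 2).
  apply: ler_sum => a _; apply: IH => x y i xy /=; apply: (bd _ _ (lift ord0 i)) => j ji.
  rewrite !ffunE; case: unliftP ji => [l ->|//] li /=; apply: xy.
  by apply: contra li => /eqP->.
have h2 : variance (fun a => \sum_b (f \o @ffun_cons n T) (a, b)) <=
    (#|{: {ffun 'I_n -> T}}|%:R * c) ^+ 2 * #|T|%:R ^+ 2.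
  apply: variance_diff => a a' /=; rewrite -sumrB.
  apply: le_trans (ler_norm_sum _ _ _) _; rewrite mulr_natl -sumr_const.
  apply: ler_sum => q _; apply: (bd _ _ ord0) => j j0.
  by rewrite !ffunE; case: unliftP j0 => [l|] -> //; rewrite eqxx.
have h1' := ler_wpM2l (ler0n R #|T|) h1.
apply: le_trans (lerD h1' h2) _; rewrite sumr_const; move: #|_| #|T| => M t.
rewrite -(mulr_natl (_ * _) t) -natr1 le_eqVlt; apply/orP; left; apply/eqP; ring.
Qed.

Lemma variance_pair_ffun (A : finType) n (T : finType) (f : A * {ffun 'I_n -> T} -> R) (c C : R) :
  (forall a, bounded_diff (fun x => f (a, x)) c) ->
  variance (fun a => \sum_x f (a, x)) <= C * (#|{: {ffun 'I_n -> T}}|%:R) ^+ 2 * #|A|%:R ^+ 2 ->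
  variance f <= (C + n%:R * c ^+ 2) * #|{: A * {ffun 'I_n -> T}}|%:R ^+ 2.
Proof.
move=> bd hC; rewrite variance_pair card_prod natrM.
have h1 : \sum_a variance (fun b => f (a, b)) <=
    \sum_(a : A) (n%:R * c ^+ 2 * #|{: {ffun 'I_n -> T}}|%:R ^+ 2).
  by apply: ler_sum => a _; apply: variance_ffun.
have h1' := ler_wpM2l (ler0n R #|A|) h1.
apply: le_trans (lerD h1' hC) _; rewrite sumr_const; move: #|_| #|A| => M t.
rewrite -(mulr_natl (_ * _) t) le_eqVlt; apply/orP; left; apply/eqP; ring.
Qed.

Lemma sum_diff_le (B : finType) (g g' : B -> R) c :
  (forall b, `|g b - g' b| <= c) -> `|\sum_b g b - \sum_b g' b| <= #|B|%:R * c.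
Proof.
move=> h; rewrite -sumrB; apply: le_trans (ler_norm_sum _ _ _) _.
by rewrite mulr_natl -sumr_const; apply: ler_sum.
Qed.

(** Each of the four blocks of [n] coordinates contributes [n * c ^ 2]. Blocks are split off from
    the last one on, and summing over a block multiplies the allowed difference by its number of
    values. *)
Lemma variance_outcome n k (f : outcome n k -> R) c :
  (forall q s t, bounded_diff (fun p => f (p, q, s, t)) c) ->
  (forall p s t, bounded_diff (fun q => f (p, q, s, t)) c) ->
  (forall p q t, bounded_diff (fun s => f (p, q, s, t)) c) ->
  (forall p q s, bounded_diff (fun t => f (p, q, s, t)) c) ->
  variance f <= 4 * n%:R * c ^+ 2 * #|{: outcome n k}|%:R ^+ 2.
Proof.
move=> bp bq bs bt.
set T := #|{: {ffun 'I_n -> {perm 'I_n}}}|%:R : R.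
set P := #|{: {ffun 'I_n -> profile k}}|%:R : R.
have -> : 4 * n%:R * c ^+ 2 = 3 * n%:R * c ^+ 2 + n%:R * c ^+ 2 by ring.
apply: variance_pair_ffun => [[[p q] s]//|].
have -> : 3 * n%:R * c ^+ 2 * T ^+ 2 =
    2 * n%:R * (T * c) ^+ 2 + n%:R * (T * c) ^+ 2 by ring.
apply: variance_pair_ffun => [[p q] x y i xy|].
  by apply: sum_diff_le => t; apply: (bs p q t _ _ i).
have -> : 2 * n%:R * (T * c) ^+ 2 * T ^+ 2 =
    n%:R * (T * (T * c)) ^+ 2 + n%:R * (T * (T * c)) ^+ 2 by ring.
apply: variance_pair_ffun => [p x y i xy|].
  by apply: sum_diff_le => s; apply: sum_diff_le => t; apply: (bq p s t _ _ i).
rewrite -/P; have -> : n%:R * (T * (T * c)) ^+ 2 * P ^+ 2 = n%:R * (P * (T * (T * c))) ^+ 2.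
  by ring.
apply: variance_ffun => x y i xy.
apply: sum_diff_le => q; apply: sum_diff_le => s; apply: sum_diff_le => t.
exact: (bp q s t _ _ i).
Qed.

Lemma variance_center (A : finType) (f : A -> R) (m : R) :
  #|A|%:R * m = \sum_x f x -> #|A|%:R * \sum_x (f x - m) ^+ 2 = variance f.
Proof.
move=> mE; rewrite /variance -mE.
have -> : \sum_x (f x - m) ^+ 2 = \sum_x f x ^+ 2 - 2 * m * \sum_x f x + #|A|%:R * m ^+ 2.
  have -> : #|A|%:R * m ^+ 2 = \sum_(x : A) m ^+ 2 by rewrite sumr_const mulr_natl.
  rewrite big_distrr /= -sumrB -big_split /=.
  by apply: eq_bigr => x _; ring.
by rewrite -mE; ring.
Qed.

End EfronStein.

(* The constant comes from [4 * 'C(n, 2) >= K ^ 2] and, by Bernoulli's inequality,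
   [(1 - 1 / K) ^ (n - 2) >= 1 / 16], where [K = #|V|]. *)
Lemma occ2_count (R : realFieldType) n (V : finType) (a : V) h :
  #|V| = (2 * h)%N -> (0 < h)%N -> (#|V| <= n < 2 * #|V|)%N ->
  (#|V| ^ n)%:R <= 64 * #|[set p : {ffun 'I_n -> V} | occ a p == 2]|%:R :> R.
Proof.
move=> VE h0 /andP[Vn nV]; rewrite card_occ.
have n2 : (2 <= n)%N by move: Vn; rewrite VE; lia.
have bin : (#|V| ^ 2 <= 4 * 'C(n, 2))%N.
  have := mul_bin_diag n 1; rewrite bin1 => E.
  have -> : (4 * 'C(n, 2) = 2 * (2 * 'C(n, 2)))%N by lia.
  by rewrite -E; move: Vn n2; rewrite -mulnn; case: n {E nV} => // m; nia.
set K := #|V|%:R : R.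
have K2 : 2 <= K by rewrite ler_nat VE; lia.
have K0 : 0 < K by lra.
set t := K^-1.
have t01 : 0 <= t <= 1.
  by rewrite invr_ge0 ltW // invf_le1 //; lra.
have tK : t * K = 1 by rewrite mulVf // gt_eqF.
have t1 : 0 <= 1 - t by lra.
have hK : h%:R * t = 1 / 2.
  have : K = 2 * h%:R by rewrite /K VE natrM.
  by move=> E; apply: (mulIf (lt0r_neq0 K0)); rewrite -mulrA tK E; lra.
have half : 1 / 2 <= (1 - t) ^+ h.
  have : (1 - h%:R * t) * (1 - t) ^+ 0 <= (1 - t) ^+ h.
    apply: (@slowly_decreasing _ (fun i => (1 - t) ^+ i) t h) => // i; last by rewrite exprS.
    exact: exprn_ge0.
  by rewrite expr0 mulr1 hK; lra.
have pw : 1 / 16 <= (1 - t) ^+ (n - 2).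
  apply: (@le_trans _ _ ((1 - t) ^+ (h * 4))).
    rewrite exprM; have : (1 / 2) ^+ 4 <= ((1 - t) ^+ h) ^+ 4.
      by rewrite lerXn2r // nnegrE; [lra|exact: exprn_ge0].
    by apply: le_trans; rewrite le_eqVlt; apply/orP; left; apply/eqP; field.
  by apply: ler_wiXn2l => //; [lra|move: nV; rewrite VE; lia].
have -> : (#|V| ^ n = #|V| ^ 2 * #|V| ^ (n - 2))%N by rewrite -expnD subnKC.
have V0 : (0 < #|V|)%N by rewrite VE muln_gt0.
have E1 : #|V|.-1%:R = K * (1 - t) by rewrite mulrBr mulr1 [K * t]mulrC tK -subn1 natrB.
rewrite natrM [X in _ <= 64 * X]natrM [X in _ <= 64 * (_ * X)]natrX E1 exprMn [X in _ * X <= _]natrX -/K.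
have bR : (#|V| ^ 2)%:R <= 4 * 'C(n, 2)%:R :> R by rewrite -natrM ler_nat.
have Kp : 0 <= K ^+ (n - 2) by rewrite exprn_ge0 // ltW.
apply: (@le_trans _ _ (4 * 'C(n, 2)%:R * K ^+ (n - 2))); first by rewrite ler_wpM2r.
have c0 : 0 <= 'C(n, 2)%:R * K ^+ (n - 2) by rewrite mulr_ge0.
move: (ler_wpM2l c0 pw); move: ('C(n, 2)%:R) (K ^+ (n - 2)) ((1 - t) ^+ (n - 2)) => x y z; lra.
Qed.

(** * Mean and variance of the number of good classes *)

Section Concentration.
Variables (R : realType) (n k : nat).
Local Notation lists := {ffun 'I_n -> {perm 'I_n}}.
Local Notation n_good o := (#|good_set o|%:R : R).

(** A class has exactly two men, and exactly two women, with probability at least 1/64 each; their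
    lists are then cyclic with probability at least 1/16. *)
Lemma sum_good_ge : (0 < k)%N -> (2 ^ k <= n < 2 * 2 ^ k)%N ->
  (2 ^ k)%:R * #|{: outcome n k}|%:R <= 16 * 64 ^+ 2 * \sum_(o : outcome n k) n_good o.
Proof.
move=> k0 hn; set T := #|{: lists}|%:R : R.
have -> : \sum_(o : outcome n k) n_good o =
    \sum_(a : profile k) \sum_(o : outcome n k) (a \in good_set o)%:R.
  rewrite exchange_big; apply: eq_bigr => o _; rewrite -sum1_card natr_sum big_mkcond.
  by apply: eq_bigr => a _; case: ifP.
rewrite big_distrr /= -card_profile mulr_natl -sumr_const; apply: ler_sum => a _.
pose c2 := #|[set p : {ffun 'I_n -> profile k} | occ a p == 2]|%:R : R.
have c2_ge : ((2 ^ k) ^ n)%:R <= 64 * c2.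
  rewrite -card_profile; apply: (@occ2_count _ _ _ _ (2 ^ k.-1)); rewrite ?expn_gt0 //.
    by rewrite card_profile -expnS prednK.
  by rewrite card_profile.
have sum_ge : c2 ^+ 2 * T ^+ 2 <= 16 * \sum_(o : outcome n k) (a \in good_set o)%:R.
  under eq_bigr do rewrite finset.inE.
  rewrite (@sum_outcome R n k (fun p q s t => (`[< good_class p q s t a >])%:R)).
  have -> : c2 ^+ 2 * T ^+ 2 = \sum_(p : {ffun 'I_n -> profile k} | occ a p == 2)
      \sum_(q : {ffun 'I_n -> profile k} | occ a q == 2) T ^+ 2.
    rewrite /c2 -sum1_card natr_sum expr2 big_distrlr /= big_distrl /=.
    apply: eq_big => [p|p _]; first by rewrite finset.inE.
    by rewrite big_distrl /=; apply: eq_big => [q|q _]; rewrite ?finset.inE // !mul1r.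
  rewrite big_distrr big_mkcond /=; apply: ler_sum => p _.
  have pos q : 0 <= 16 * \sum_(s : lists) \sum_(t : lists) (`[< good_class p q s t a >])%:R :> R.
    by rewrite mulr_ge0 // sumr_ge0 // => s _; rewrite sumr_ge0.
  rewrite big_distrr; case: ifP => [/cards2P[m1 [m2 [m12 EA]]]|_]; last by apply: sumr_ge0 => q _; exact: pos.
  rewrite big_mkcond /=; apply: ler_sum => q _.
  case: ifP => [/cards2P[w1 [w2 [w12 EB]]]|_]; last exact: pos.
  apply: le_trans (sum_cyclic R m12 w12) _; rewrite ler_wpM2l //.
  apply: ler_sum => s _; apply: ler_sum => t _; rewrite ler_nat.
  case: (boolP (cyclic _ _ _ _ _ _)) => // cyc; rewrite asboolT //.
  by exists m1, m2, w1, w2.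
rewrite card_outcome natrM !(natrX R _ 2) -/T.
have c2T : 0 <= T ^+ 2 by rewrite exprn_ge0.
apply: (@le_trans _ _ ((64 * c2) ^+ 2 * T ^+ 2)).
  by rewrite ler_wpM2r // lerXn2r ?nnegrE // mulr_ge0 // ler0n.
rewrite exprMn -mulrA.
have k64 : 0 <= 64 ^+ 2 :> R by apply: exprn_ge0.
have := ler_wpM2l k64 sum_ge; move: (\sum_o _) (64 ^+ 2 : R) => x y; lra.
Qed.

Lemma good_class_ext (p p' q q' : {ffun 'I_n -> profile k}) (s s' t t' : lists) a :
  class_of p a = class_of p' a -> class_of q a = class_of q' a ->
  (forall i, p i = a -> s i = s' i) -> (forall i, q i = a -> t i = t' i) ->
  good_class p q s t a -> good_class p' q' s' t' a.
Proof.
move=> Ep Eq Es Et [m1 [m2 [w1 [w2 [EA EB cyc]]]]]; exists m1, m2, w1, w2.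
have pa m : m \in [set m1; m2] -> p m = a by rewrite -EA finset.inE => /eqP.
have qa w : w \in [set w1; w2] -> q w = a by rewrite -EB finset.inE => /eqP.
rewrite -Ep -Eq; split=> //; move: cyc; rewrite /cyclic /list_pref.
by rewrite !Es ?pa ?inE ?eqxx ?orbT // !Et ?qa ?inE ?eqxx ?orbT.
Qed.

(** Only [a] and [b] can change status, so each set of good classes lies in the other enlarged by
    these two. *)
Lemma card_good_diff (o o' : outcome n k) (a b : profile k) :
  (forall c, c != a -> c != b -> class_of o.1.1.1 c = class_of o'.1.1.1 c) ->
  (forall c, c != a -> c != b -> class_of o.1.1.2 c = class_of o'.1.1.2 c) ->
  (forall i, o.1.1.1 i != a -> o.1.1.1 i != b -> o.1.2 i = o'.1.2 i) ->
  (forall i, o.1.1.2 i != a -> o.1.1.2 i != b -> o.2 i = o'.2 i) ->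
  `|n_good o - n_good o'| <= 2.
Proof.
move=> hp hq hs ht.
have E c : c != a -> c != b -> (c \in good_set o) = (c \in good_set o').
  move=> ca cb; rewrite !finset.inE; apply/asboolP/asboolP; apply: good_class_ext.
  - exact: hp.
  - exact: hq.
  - by move=> i ic; apply: hs; rewrite ic.
  - by move=> i ic; apply: ht; rewrite ic.
  - by rewrite hp.
  - by rewrite hq.
  - move=> i ic; apply/esym; have /eqP : i \in class_of o.1.1.1 c = true by rewrite hp // finset.inE ic eqxx.
    by rewrite eqb_id finset.inE => /eqP ic'; apply: hs; rewrite ic'.
  - move=> i ic; apply/esym; have /eqP : i \in class_of o.1.1.2 c = true by rewrite hq // finset.inE ic eqxx.
    by rewrite eqb_id finset.inE => /eqP ic'; apply: ht; rewrite ic'.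
have le (G G' : {set profile k}) : (forall c, c != a -> c != b -> c \in G -> c \in G') ->
    #|G|%:R <= #|G'|%:R + 2 :> R.
  move=> h; rewrite -natrD ler_nat; apply: leq_trans (_ : #|G' :|: [set a; b]| <= _)%N.
    apply/subset_leq_card/fintype.subsetP => c cG; rewrite !finset.inE.
    by case: eqVneq => [_|ca]; rewrite ?orbT //; case: eqVneq => [_|cb]; rewrite ?orbT //= (h c).
  by rewrite (leq_trans (leq_card_setU _ _)) // leq_add2l cards2; case: (_ != _).
have l1 : n_good o <= n_good o' + 2 by apply: le => c ca cb; rewrite E.
have l2 : n_good o' <= n_good o + 2 by apply: le => c ca cb; rewrite E.
by rewrite ler_norml; lra.
Qed.

(** Changing a profile touches the class left and the class entered, changing a list only one class;
    hence [c = 2] and [4 * 2 ^ 2 = 16]. *)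
Lemma variance_good : variance (fun o : outcome n k => n_good o) <=
  16 * n%:R * #|{: outcome n k}|%:R ^+ 2.
Proof.
have -> : 16 * n%:R = 4 * n%:R * 2 ^+ 2 :> R by ring.
have cls (x y : {ffun 'I_n -> profile k}) i : (forall j, j != i -> x j = y j) ->
    forall c, c != x i -> c != y i -> class_of x c = class_of y c.
  move=> xy c cx cy; apply/setP => j; rewrite !finset.inE.
  by have [->|/xy->//] := eqVneq j i; rewrite ![_ == c]eq_sym (negPf cx) (negPf cy).
apply: variance_outcome => [q s t x y i xy|p s t x y i xy|p q t x y i xy|p q s x y i xy].
- by apply: (@card_good_diff _ _ (x i) (y i)) => //=; apply: cls.
- by apply: (@card_good_diff _ _ (x i) (y i)) => //=; apply: cls.
- apply: (@card_good_diff _ _ (p i) (p i)) => //= j ji _.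
  by apply: xy; apply: contra ji => /eqP->.
- apply: (@card_good_diff _ _ (q i) (q i)) => //= j ji _.
  by apply: xy; apply: contra ji => /eqP->.
Qed.

End Concentration.

(** * Asymptotics *)

Local Open Scope classical_set_scope.
Local Open Scope ring_scope.

Lemma near_infty (P : nat -> Prop) (N : nat) :
  (forall n, (N <= n)%N -> P n) -> \forall n \near \oo, P n.
Proof. by move=> h; exists N => //= n /h. Qed.

(** Markov's inequality. *)
Lemma prob_multi_le (R : realType) n k (d : profile k -> profile k -> R) (th delta : R) :
  0 < delta -> (0 < n)%N ->
  \sum_(o : outcome n k) (n_multi d o)%:R <= th * n%:R * #|{: outcome n k}|%:R ->
  prob R (fun o : outcome n k => delta < (n_multi d o)%:R / (2 * n)%:R) <= th / (2 * delta).
Proof.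
move=> delta0 n0 h; rewrite /prob; set E := [set o | _]%SET.
have n0' : 0 < n%:R :> R by rewrite ltr0n.
have O0 : 0 < #|{: outcome n k}|%:R :> R.
  by rewrite ltr0n card_outcome muln_gt0 !expn_gt0 /= card_ffun card_ord expn_gt0;
    rewrite (_ : 0 < #|{perm 'I_n}|)%N //; apply/card_gt0P; exists 1%g.
rewrite ler_pdivrMr //.
have : #|E|%:R * (delta * (2 * n%:R)) <= th * n%:R * #|{: outcome n k}|%:R.
  apply: le_trans h; rewrite mulr_natl -sumr_const.
  rewrite [leRHS](bigID (mem E)) /= ler_wpDr ?sumr_ge0 //; apply: ler_sum => o.
  by rewrite finset.inE ltr_pdivlMr ?ltr0n ?muln_gt0 // natrM => /ltW.
move: (#|E|%:R) (#|{: outcome n k}|%:R) n0' => e t; move: (n%:R) => x x0 h'.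
rewrite mulrAC ler_pdivlMr ?mulr_gt0 // -(ler_pM2r x0); lra.
Qed.

(** From [2 ^ k < n ^ (1 - eps)] follows [n / 2 ^ k > n ^ eps], which is at least [S] once
    [ln n >= ln S / eps]. *)
Lemma size_ratio_unbounded (R : realType) (eps : R) (kk : nat -> nat) :
  0 < eps -> (exists N : nat, forall n : nat, (N <= n)%N ->
        (kk n)%:R < (1 - eps) * log2 (n%:R : R)) ->
  forall S : nat, exists N, forall n, (N <= n)%N -> (S * 2 ^ kk n <= n)%N.
Proof.
move=> eps0 [N hN] S.
have [S0|S0] := posnP S; first by exists 0%N => n _; rewrite S0.
have [M hM] : exists M : nat, ln S%:R / eps <= M%:R.
  by exists (Num.truncn (ln S%:R / eps)).+1; apply/ltW/truncnS_gt.
exists (maxn (maxn N 1) (Num.truncn (expR M%:R : R)).+1) => n.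
rewrite !geq_max => /andP[/andP[/hN kn n0] nM].
have n0' : 0 < n%:R :> R by rewrite ltr0n.
have l2 : 0 < ln 2 :> R by rewrite ln_gt0 // ltr1n.
rewrite -(ler_nat R) natrM natrX -ler_ln ?posrE ?mulr_gt0 ?exprn_gt0 ?ltr0n //.
rewrite lnM ?posrE ?exprn_gt0 ?ltr0n // lnXn // -(mulr_natl (ln 2)).
have lnn : M%:R <= ln n%:R :> R.
  rewrite -[leLHS](@expRK R) ler_ln ?posrE ?expR_gt0 //.
  by apply: ltW; apply: lt_le_trans (truncnS_gt _) _; rewrite ler_nat.
move: kn; rewrite /log2 mulrA ltr_pdivlMr //.
have : ln S%:R <= eps * ln n%:R.
  by move: hM; rewrite ler_pdivrMr // => /le_trans; apply; rewrite mulrC ler_wpM2l // ltW.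
by move: (ln n%:R) (_ * ln 2) (ln S%:R) => x y z; lra.
Qed.

Lemma small_fraction_multi (R : realType) (d : forall k : nat, profile k -> profile k -> R)
  (hd : forall k : nat, is_metric (d k)) (kk : nat -> nat) (delta : R) :
  (forall n, (1 <= kk n)%N) ->
  (forall S : nat, exists N, forall n, (N <= n)%N -> (S * 2 ^ kk n <= n)%N) ->
  0 < delta ->
  (fun n : nat => prob R (fun o : outcome n (kk n) =>
      delta < (n_multi (d (kk n)) o)%:R / (2 * n)%:R)) @ \oo --> (0 : R).
Proof.
move=> kk1 hS delta0; apply/cvgrPdist_lt => e e0.
(* With [th = delta * e], Markov's bound is [e / 2]. *)
have [S hSum] := sum_n_multi_le (mulr_gt0 delta0 e0).
have [N hN] := hS S; apply: (@near_infty _ (maxn N 1)) => n.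
rewrite geq_max => /andP[Nn n0].
rewrite sub0r normrN ger0_norm; last by rewrite /prob divr_ge0.
have := prob_multi_le delta0 n0 (hSum n (kk n) _ (hd _) (kk1 n) (hN n Nn)).
move/le_lt_trans; apply; rewrite ltr_pdivrMr ?mulr_gt0 //; nra.
Qed.

Lemma outcome_gt0 n k : (0 < #|{: outcome n k}|)%N.
Proof.
by apply/card_gt0P; exists ([ffun=> [ffun=> true]], [ffun=> [ffun=> true]], [ffun=> 1%g], [ffun=> 1%g]).
Qed.

(** Chebyshev's inequality. The mean is at least [2 * c * n] because [2 ^ k > n / 2], so having
    fewer than [c * n] good classes is a deviation of at least [c * n], while the variance is at
    most [16 * n]. *)
Lemma few_good_le (R : realType) n k (c : R) : c = (16 * 64 ^+ 2)^-1 / 4 ->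
  (0 < k)%N -> (2 ^ k <= n < 2 * 2 ^ k)%N ->
  prob R (fun o : outcome n k => #|good_set o|%:R < c * n%:R) <= 16 / (c ^+ 2 * n%:R).
Proof.
move=> cE k0 hn; set W := #|{: outcome n k}|%:R : R.
have W0 : 0 < W by rewrite ltr0n outcome_gt0.
have kap0 : 0 < (16 * 64 ^+ 2)^-1 :> R by rewrite invr_gt0 mulr_gt0 // exprn_gt0.
have c0 : 0 < c by rewrite cE divr_gt0.
have n0 : 0 < n%:R :> R.
  by rewrite ltr0n; case/andP: hn => + _; apply: leq_trans; rewrite expn_gt0.
have nK : n%:R <= 2 * (2 ^ k)%:R :> R.
  by rewrite -natrM ler_nat; case/andP: hn => _ /ltnW.
set f := fun o : outcome n k => #|good_set o|%:R : R.
set mu := (\sum_o f o) / W.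
have muE : W * mu = \sum_o f o by rewrite mulrC divfK ?gt_eqF.
have mu_ge : 2 * c * n%:R <= mu.
  rewrite ler_pdivlMr //.
  have : (2 ^ k)%:R * W <= (16 * 64 ^+ 2) * \sum_o f o := sum_good_ge R k0 hn.
  rewrite -ler_pdivrMl ?mulr_gt0 ?exprn_gt0 //; apply: le_trans.
  rewrite cE -/W; move: (_^-1) kap0 => x x0.
  have : n%:R * (x * W) <= 2 * (2 ^ k)%:R * (x * W).
    by rewrite ler_wpM2r // mulr_ge0 // ltW.
  by move: (n%:R) ((2 ^ k)%:R : R) => y z; lra.
have vf : \sum_o (f o - mu) ^+ 2 <= 16 * n%:R * W.
  rewrite -(ler_pM2l W0) (variance_center muE); apply: le_trans (variance_good R n k) _.
  by rewrite -/W le_eqVlt; apply/orP; left; apply/eqP; ring.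
rewrite /prob -/W; set E := [set o | _]%SET.
have : #|E|%:R * (c * n%:R) ^+ 2 <= 16 * n%:R * W.
  apply: le_trans vf; rewrite mulr_natl -sumr_const.
  rewrite [leRHS](bigID (mem E)) /= ler_wpDr ?sumr_ge0 // => [o _|]; first exact: sqr_ge0.
  apply: ler_sum => o; rewrite finset.inE -/(f o) => fo.
  have cn0 := mulr_gt0 c0 n0; have le_gap : c * n%:R <= mu - f o by lra.
  by rewrite -[leRHS]sqrrN opprB lerXn2r // nnegrE; lra.
rewrite ler_pdivrMr // => h.
rewrite mulrAC ler_pdivlMr ?mulr_gt0 ?exprn_gt0 // -(ler_pM2r n0).
by apply: le_trans (le_trans h _); rewrite le_eqVlt; apply/orP; left; apply/eqP; ring.
Qed.

Lemma many_stable (R : realType) (d : forall k : nat, profile k -> profile k -> R)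
  (hd : forall k : nat, is_metric (d k)) : exists c : R, 0 < c /\
  (fun n : nat => prob R (fun o : outcome n (trunc_log 2 n) =>
     (c * n%:R <= (n_multi (d (trunc_log 2 n)) o)%:R)
     && (expR (c * n%:R) <= (n_stable_matchings (d (trunc_log 2 n)) o)%:R)))
  @ \oo --> (1 : R).
Proof.
pose c1 : R := (16 * 64 ^+ 2)^-1 / 4.
have c10 : 0 < c1 by rewrite divr_gt0 // invr_gt0 mulr_gt0 // exprn_gt0.
have l2 : 0 < ln 2 :> R by rewrite ln_gt0 // ltr1n.
have l21 : ln 2 <= 1 :> R.
  by rewrite -[leRHS](@expRK R) ler_ln ?posrE ?expR_gt0 //; apply: le_trans (expR_ge1Dx 1); lra.
(* [g] good classes give at least [2 ^ g = expR (g * ln 2)] stable matchings; as [ln 2 <= 1], the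
   same constant serves for counting participants. *)
exists (c1 * ln 2); split; first exact: mulr_gt0.
apply/cvgrPdist_lt => e e0.
apply: (@near_infty _ (maxn 2 (Num.truncn (16 / c1 ^+ 2 / e)).+1)) => n.
rewrite geq_max => /andP[n2 nN]; set k := trunc_log 2 n.
have n0 : (0 < n)%N by apply: leq_trans n2.
have k0 : (0 < k)%N by rewrite trunc_log_gt0.
have hn : (2 ^ k <= n < 2 * 2 ^ k)%N.
  by rewrite trunc_logP //= -expnS trunc_log_ltn.
have few := few_good_le (erefl c1) k0 hn.
have W0 : 0 < #|{: outcome n k}|%:R :> R by rewrite ltr0n outcome_gt0.
set P := (P in prob R P); set Q := (Q in prob R Q) in few.
have PQ o : ~~ Q o -> P o.
  rewrite /Q /P -leNgt => h; have [M Mst] := stable_exists (d k) o.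
  have ng : c1 * ln 2 * n%:R <= #|good_set o|%:R * ln 2 by rewrite mulrAC ler_wpM2r // ltW.
  apply/andP; split.
    apply: (@le_trans _ _ #|good_set o|%:R); last by rewrite ler_nat; exact: good_le_multi Mst.
    by apply: le_trans ng _; rewrite ler_piMr.
  apply: (@le_trans _ _ ((2 ^ #|good_set o|)%:R)); last by rewrite ler_nat; exact: exp_good_le Mst.
  by rewrite natrX -[X in _ <= X ^+ _](@lnK R) ?posrE // -expRM_natl ler_expR.
have sum1 : 1 <= prob R P + prob R Q.
  rewrite /prob -mulrDl ler_pdivlMr // mul1r -natrD ler_nat.
  apply: leq_trans (leq_card_setU _ _); rewrite -cardsT.
  apply/subset_leq_card/fintype.subsetP => o _; rewrite !finset.inE.
  by apply/orP; case: (boolP (Q o)) => [Qo|/PQ Po]; [right|left].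
have P1 : prob R P <= 1.
  by rewrite /prob ler_pdivrMr // mul1r ler_nat max_card.
rewrite ger0_norm ?subr_ge0 //.
apply: (@le_lt_trans _ _ (prob R Q)); first by rewrite lerBlDl.
apply: le_lt_trans few _.
have nR : 16 / c1 ^+ 2 / e < n%:R.
  by apply: lt_le_trans (truncnS_gt _) _; rewrite ler_nat.
have c2 : 0 < c1 ^+ 2 by rewrite exprn_gt0.
have n0' : 0 < n%:R :> R by rewrite ltr0n.
rewrite ltr_pdivrMr; last exact: mulr_gt0.
move: nR; rewrite ltr_pdivrMr // ltr_pdivrMr //.
by move: (c1 ^+ 2) (n%:R) => x y; lra.
Qed.

(** In (ii) an upper bound linear in [n] is immediate, there being [2 * n] participants; what is
    asserted is the matching lower bound. *)
Theorem theorem3p2 (R : realType)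
  (d : forall k : nat, profile k -> profile k -> R)
  (hd : forall k : nat, is_metric (d k))
  (eps : R) (heps : 0 < eps) :
  (* (i) *)
  (forall kk : nat -> nat,
     (forall n, (1 <= kk n)%N) ->
     (exists N : nat, forall n : nat, (N <= n)%N ->
        (kk n)%:R < (1 - eps) * log2 (n%:R : R)) ->
     forall delta : R, 0 < delta ->
       (fun n : nat =>
          @prob R n (kk n)
            (fun o => delta < (n_multi (d (kk n)) o)%:R / (2 * n)%:R))
         @ \oo --> (0 : R))
  /\
  (* (ii) k = floor(log2 n) *)
  (exists c : R, 0 < c /\
     (fun n : nat =>
        @prob R n (trunc_log 2 n)
          (fun o => (c * n%:R <= (n_multi (d (trunc_log 2 n)) o)%:R)
                    && (expR (c * n%:R) <=
                        (n_stable_matchings (d (trunc_log 2 n)) o)%:R)))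
       @ \oo --> (1 : R)).
Proof.
split; last exact: many_stable.
move=> kk kk1 small delta delta0; apply: small_fraction_multi => //.
exact: size_ratio_unbounded small.
Qed.
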